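(* The following problem (the $2$-knapsack problem for symmetric groups) can be solved in polynomial time. Input: a unary encoded number $m\in\mathbb{N}$ and permutations $a,a_1,a_2\in S_m$. Question: are there $i_1,i_2\in\mathbb{N}$ such that $a=a_1^{i_1}a_2^{i_2}$?
   Context: $S_m$ is the symmetric group of all permutations of $\{1,\dots,m\}$; permutations are multiplied from left to right. $\mathbb{N}$ contains $0$. *)

(* Defs.v *)
From HB Require Import structures.
From mathcomp Require Import all_boot all_algebra all_fingroup.

Set Implicit Arguments.
Unset Strict Implicit.
Unset Printing Implicit Defensive.

(* Deterministic multi-tape Turing machines over the input alphabet {0,1}.    *)

Inductive move := MoveLeft | Stay | MoveRight.

(* Tapes are infinite in both directions: cells beyond the two lists are      *)
(* blank.  Both lists start with the cell next to the head.                   *)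
Record tape (A : Type) := Tape {
  left_cells : seq A; current : A; right_cells : seq A }.

Definition write_move (A : Type) (blank : A) (t : tape A) (am : A * move) :
    tape A :=
  let: Tape l _ r := t in
  let: (x, d) := am in
  match d with
  | MoveLeft => Tape (behead l) (head blank l) (x :: r)
  | Stay => Tape l x r
  | MoveRight => Tape (x :: l) (head blank r) (behead r)
  end.

Definition tape_of_seq (A : Type) (blank : A) (s : seq A) : tape A :=
  Tape [::] (head blank s) (behead s).

(* The machine has tm_extra.+1 tapes, tape ord0 being the input tape; all     *)
(* tapes are readable and writable.  A state q with tm_verdict q = Some b is  *)
(* halting, with answer b.                                                    *)
Record TM := MkTM {
  tm_extra : nat;
  tm_state : finType;
  tm_symbol : finType;
  tm_start : tm_state;
  tm_verdict : tm_state -> option bool;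
  tm_blank : tm_symbol;
  tm_bit : bool -> tm_symbol;
  tm_bit_inj : injective tm_bit;
  tm_bit_blank : forall b, tm_bit b != tm_blank;
  tm_trans : tm_state -> {ffun 'I_tm_extra.+1 -> tm_symbol} ->
             tm_state * ('I_tm_extra.+1 -> tm_symbol * move) }.

Record config (M : TM) := Config {
  cfg_state : tm_state M;
  cfg_tapes : 'I_(tm_extra M).+1 -> tape (tm_symbol M) }.

Definition init_config (M : TM) (w : seq bool) : config M :=
  Config (tm_start M)
    (fun i => tape_of_seq (tm_blank M)
                (if i == ord0 then map (@tm_bit M) w else [::])).

Definition step (M : TM) (c : config M) : config M :=
  if tm_verdict (cfg_state c) is Some _ then c else
  let: (q, act) :=
    tm_trans (cfg_state c) [ffun i => current (cfg_tapes c i)] in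
  Config q (fun i => write_move (tm_blank M) (cfg_tapes c i) (act i)).

Definition polynomial_time (L : seq bool -> Prop) : Prop :=
  exists (M : TM) (p : {poly nat}), forall w : seq bool,
  exists b : bool,
    tm_verdict (cfg_state (iter p.[size w]%R (@step M) (init_config M w)))
      = Some b
    /\ (b <-> L w).

Definition unary (n : nat) : seq bool := rcons (nseq n true) false.

(* The image table of s; the point i of 'I_m stands for i + 1 in {1,...,m}.   *)
Definition encode_perm (m : nat) (s : 'S_m) : seq bool :=
  flatten [seq unary (val (s i)) | i <- enum 'I_m].

(* Unary codes are self-delimiting and the first one gives m, so this         *)
(* determines m, a, a1 and a2.                                                *)
Definition encode_instance (m : nat) (a a1 a2 : 'S_m) : seq bool :=
  unary m ++ encode_perm a ++ encode_perm a1 ++ encode_perm a2.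

(* Main.v *)
(** Fix a cycle of [a1] through a point [c]. The pairs [(i, j)] of integers for
    which [a1^i a2^j] agrees with [a] on that cycle form a set closed under
    [x - y + z]. In Z^2 such sets obey a Helly theorem: if every three of a finite
    family meet, all of them meet; in Z it is enough that every two meet. So the
    instance is solvable iff for all points [c1], [c2], [c3] there is [i] such that
    for any two points on the [a1]-cycles of the [c]s some [j] makes [a1^i a2^j]
    agree with [a] at both. Here [i] may be taken below the product of three cycle
    lengths and [j] below the product of two, so brute force over tuples of
    numbers bounded by the input length decides the problem. Such a search is a
    program with finitely many counters bounded by the input length, and a counter
    is the position of a head on a copy of the input. *)

Require Import Defs.
From mathcomp Require Import all_boot all_algebra all_fingroup zify ring.

Set Implicit Arguments.
Unset Strict Implicit.
Unset Printing Implicit Defensive.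

(** * A Helly theorem for cosets in the plane *)

Section Helly.
Local Open Scope ring_scope.
Import GRing.Theory Num.Theory.

(** The unit of the Helly argument is an [a1]-cycle and not a point: at a single point the set of
    solutions need not be closed under x - y + z, because a change of i moves the point to another
    one, where agreement is not known. Once i is fixed this obstacle disappears, and points suffice
    for j.

    Sizes: the unary image table of a permutation of m points has length m(m+1)/2 whatever the
    permutation, so m^2 <= n for the input length n. Hence j, below m^2, fits in one counter,
    whereas i, below m^3 <= (n+1)^2, is held as two digits in base n+1.

    The search is written as an expression of a small language with bounded recursion and compiled
    to counter programs. The running time is then bounded by induction on expressions, and the
    search reads as a formula with quantifiers over 0, ..., n. *)

Lemma primitive_triple (a b c : int) : (a != 0) || (b != 0) || (c != 0) ->
  exists g a' b' c' s t u : int,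
    [/\ g != 0, a = g * a', b = g * b', c = g * c'
      & s * a' + t * b' + u * c' = 1].
Proof.
move=> h.
have [u1 [v1 e1]] := Bezoutz a b.
have [u2 [v2 e2]] := Bezoutz (gcdz a b) c.
set g := gcdz _ c in e2.
have g0 : g != 0 by rewrite /g !gcdz_eq0 -!negb_and in h *; apply: contra h.
have /dvdzP[a' ha] : (g %| a)%Z := dvdz_trans (dvdz_gcdl _ _) (dvdz_gcdl _ _).
have /dvdzP[b' hb] : (g %| b)%Z := dvdz_trans (dvdz_gcdl _ _) (dvdz_gcdr _ _).
have /dvdzP[c' hc] : (g %| c)%Z := dvdz_gcdr _ _.
exists g, a', b', c', (u2 * u1), (u2 * v1), v2.
split; rewrite // 1?mulrC //.
by apply: (mulfI g0); rewrite mulr1 -[RHS]e2 -e1 ha hb hc; ring.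
Qed.

(** The 2 by 2 minors are the coefficients of a relation between three plane vectors. If all of them
    vanish, the first two vectors are parallel and already satisfy a nontrivial relation, possibly
    because the first is zero. Making the relation primitive replaces the division in Radon's
    theorem. *)
Lemma plane_relation (x1 y1 x2 y2 x3 y3 : int) :
  exists a b c s t u : int,
    [/\ a * x1 + b * x2 + c * x3 = 0, a * y1 + b * y2 + c * y3 = 0
      & s * a + t * b + u * c = 1].
Proof.
suff [a [b [c [h ex ey]]]] : exists a b c : int,
    [/\ (a != 0) || (b != 0) || (c != 0), a * x1 + b * x2 + c * x3 = 0
      & a * y1 + b * y2 + c * y3 = 0].
  have [g [a' [b' [c' [s [t [u [g0 ea eb ec e]]]]]]]] := primitive_triple h.
  exists a', b', c', s, t, u; split=> //; apply: (mulfI g0); rewrite mulr0.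
    by rewrite -ex ea eb ec; ring.
  by rewrite -ey ea eb ec; ring.
have [d0|dn0] := boolP ((x2 * y3 - x3 * y2 != 0) || (x3 * y1 - x1 * y3 != 0)
  || (x1 * y2 - x2 * y1 != 0)).
  by do 3 eexists; split; [exact: d0|ring|ring].
move: dn0; rewrite !negb_or !negbK => /andP[_ /eqP d12].
have [x10|x10] := boolP (x1 != 0).
  exists x2, (- x1), 0; rewrite oppr_eq0 x10 orbT; split=> //; first by ring.
  apply: etrans (_ : - (x1 * y2 - x2 * y1) = 0); first by ring.
  by rewrite d12 oppr0.
have [y10|y10] := boolP (y1 != 0).
  exists y2, (- y1), 0; rewrite oppr_eq0 y10 orbT; split=> //; last by ring.
  by apply: etrans d12; ring.
exists 1, 0, 0; move: x10 y10; rewrite !negbK => /eqP-> /eqP->.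
by split; rewrite // ?oner_eq0 //; ring.
Qed.

Definition affine1 (P : int -> Prop) :=
  forall x y z, P x -> P y -> P z -> P (x - y + z).

Definition affine2 (P : int -> int -> Prop) :=
  forall x x' y y' z z', P x x' -> P y y' -> P z z' ->
    P (x - y + z) (x' - y' + z').

Lemma affine2_line P x x' y y' k : affine2 P -> P x x' -> P y y' ->
  P (x + k * (y - x)) (x' + k * (y' - x')).
Proof.
move=> aP px py; case: k => k; last rewrite NegzE.
  elim: k => [|k IH]; first by rewrite !mul0r !addr0.
  have := aP _ _ _ _ _ _ IH px py; congr (P _ _);
    by rewrite -addn1 PoszD; ring.
elim: k.+1 => [|k' IH]; first by rewrite oppr0 !mul0r !addr0.
have := aP _ _ _ _ _ _ IH py px; congr (P _ _);
  by rewrite -addn1 PoszD; ring.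
Qed.

Lemma affine2_comb P x x' y y' z z' a b c : affine2 P ->
  P x x' -> P y y' -> P z z' -> a + b + c = 1 ->
  P (a * x + b * y + c * z) (a * x' + b * y' + c * z').
Proof.
move=> aP px py pz e.
have := aP _ _ _ _ _ _ (affine2_line b aP px py) px (affine2_line c aP px pz).
have -> : a = 1 - b - c by rewrite -e; ring.
by congr (P _ _); ring.
Qed.

(* With sum c_i x_i = sum c_i = 0 and sum s_i c_i = 1, the point sum s_i c_i x_i
   is, for each k, an affine combination of the x_i with i <> k. *)
Lemma helly2 P1 P2 P3 P4 :
  affine2 P1 -> affine2 P2 -> affine2 P3 -> affine2 P4 ->
  (exists x y, [/\ P2 x y, P3 x y & P4 x y]) ->
  (exists x y, [/\ P1 x y, P3 x y & P4 x y]) ->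
  (exists x y, [/\ P1 x y, P2 x y & P4 x y]) ->
  (exists x y, [/\ P1 x y, P2 x y & P3 x y]) ->
  exists x y, [/\ P1 x y, P2 x y, P3 x y & P4 x y].
Proof.
move=> a1 a2 a3 a4 [x1 [y1 [p12 p13 p14]]] [x2 [y2 [p21 p23 p24]]].
move=> [x3 [y3 [p31 p32 p34]]] [x4 [y4 [p41 p42 p43]]].
have [a [b [c [s [t [u [ex ey e]]]]]]] :=
  plane_relation (x1 - x4) (y1 - y4) (x2 - x4) (y2 - y4) (x3 - x4) (y3 - y4).
exists (s * a * x1 + t * b * x2 + u * c * x3), (s * a * y1 + t * b * y2 + u * c * y3).
(* The fourth point has coefficient -(a + b + c) in the relation and weight 0 in the sum.
   Subtracting [w] times the relation, for [w] equal to [s], [t] or [u], cancels the term of the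
   first, second or third point. *)
have hy (z1 z2 z3 z4 w : int) :
    a * (z1 - z4) + b * (z2 - z4) + c * (z3 - z4) = 0 ->
  s * a * z1 + t * b * z2 + u * c * z3 =
  s * a * z1 + t * b * z2 + u * c * z3 - w * (a * (z1 - z4) + b * (z2 - z4) + c * (z3 - z4)).
  by move=> ->; rewrite mulr0 subr0.
split.
- rewrite (hy _ _ _ _ s ex) (hy _ _ _ _ s ey).
  have := affine2_comb (a := t * b - s * b) (b := u * c - s * c)
    (c := s * (a + b + c)) a1 p21 p31 p41.
  by rewrite -e => /(_ ltac:(ring)); congr (P1 _ _); ring.
- rewrite (hy _ _ _ _ t ex) (hy _ _ _ _ t ey).
  have := affine2_comb (a := s * a - t * a) (b := u * c - t * c)
    (c := t * (a + b + c)) a2 p12 p32 p42.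
  by rewrite -e => /(_ ltac:(ring)); congr (P2 _ _); ring.
- rewrite (hy _ _ _ _ u ex) (hy _ _ _ _ u ey).
  have := affine2_comb (a := s * a - u * a) (b := t * b - u * b)
    (c := u * (a + b + c)) a3 p13 p23 p43.
  by rewrite -e => /(_ ltac:(ring)); congr (P3 _ _); ring.
- exact: affine2_comb.
Qed.

Lemma affine2_and P Q : affine2 P -> affine2 Q ->
  affine2 (fun x y => P x y /\ Q x y).
Proof.
by move=> aP aQ x x' y y' z z' [? ?] [? ?] [? ?]; split; [apply: aP|apply: aQ].
Qed.

Lemma helly2_seq (I : eqType) (s : seq I) (P : I -> int -> int -> Prop) :
  (forall i, affine2 (P i)) ->
  {in s & &, forall i j k, exists x y, [/\ P i x y, P j x y & P k x y]} ->
  exists x y, {in s, forall i, P i x y}.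
Proof.
move=> aP hP.
(* The sets already treated are collected in [Q]. Passing to the intersection of [Q] and [P a]
   requires a common point of [Q], [P a], [P i] and [P j], which is the case of four sets. *)
suff gen : forall Q, affine2 Q -> (exists x y, Q x y) ->
    {in s &, forall i j, exists x y, [/\ Q x y, P i x y & P j x y]} ->
    exists x y, Q x y /\ {in s, forall i, P i x y}.
  have [||i j si sj|x [y [_ h]]] := gen (fun _ _ => True); last by exists x, y.
  - by [].
  - by exists 0, 0.
  - by have [x [y [? ? _]]] := hP i j j si sj sj; exists x, y.
elim: s hP => [|a s IH] hP Q aQ [x [y q]] hQ; first by exists x, y.
have sub i : i \in s -> i \in a :: s by rewrite inE orbC => ->.
have ha : a \in a :: s by rewrite inE eqxx.
have [|||i j si sj|x' [y' [[q' pa] h]]] := IH _ (fun x y => Q x y /\ P a x y).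
- by move=> i j k /sub si /sub sj /sub sk; exact: hP.
- exact: affine2_and.
- by have [x' [y' [? ? _]]] := hQ a a ha ha; exists x', y'.
- have [||||x' [y' [? ? ? ?]]] := helly2 aQ (aP a) (aP i) (aP j); last by exists x', y'.
  + by apply: hP => //; apply: sub.
  + by apply: hQ; apply: sub.
  + by apply: hQ => //; apply: sub.
  + by apply: hQ => //; apply: sub.
- by exists x', y'; split=> // i; rewrite inE => /predU1P[->|/h].
Qed.

Lemma helly1 P1 P2 P3 : affine1 P1 -> affine1 P2 -> affine1 P3 ->
  (exists x, P2 x /\ P3 x) -> (exists x, P1 x /\ P3 x) ->
  (exists x, P1 x /\ P2 x) -> exists x, [/\ P1 x, P2 x & P3 x].
Proof.
move=> a1 a2 a3 [x1 [p12 p13]] [x2 [p21 p23]] [x3 [p31 p32]].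
have lift P : affine1 P -> affine2 (fun x _ => P x).
  by move=> aP x x' y y' z z'; apply: aP.
have line P x y k : affine1 P -> P x -> P y -> P (x + k * (y - x)).
  by move=> /lift aP px py; apply: (affine2_line (x' := 0) (y' := 0) k aP).
(* The third vector (0, 1) forces [c = 0], so the plane relation becomes a primitive relation
   between two integers. *)
have [a [b [c [s [t [u [ex ec e]]]]]]] := plane_relation (x1 - x3) 0 (x2 - x3) 0 0 1.
have c0 : c = 0 by rewrite -ec; ring.
move: ex e; rewrite {}c0 !mulr0 !addr0 => ex e.
have hy w : s * a * x1 + t * b * x2 =
    s * a * x1 + t * b * x2 - w * (a * (x1 - x3) + b * (x2 - x3)).
  by rewrite ex mulr0 subr0.
exists (s * a * x1 + t * b * x2); split.
- rewrite (hy s); have := line _ _ _ (t * b - s * b) a1 p31 p21.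
  have -> : t * b = 1 - s * a by rewrite -e; ring.
  by congr (P1 _); ring.
- rewrite (hy t); have := line _ _ _ (s * a - t * a) a2 p32 p12.
  have -> : s * a = 1 - t * b by rewrite -e; ring.
  by congr (P2 _); ring.
- have := line _ _ _ (t * b) a3 p13 p23.
  have -> : s * a = 1 - t * b by rewrite -e; ring.
  by congr (P3 _); ring.
Qed.

Lemma affine1_and P Q : affine1 P -> affine1 Q -> affine1 (fun x => P x /\ Q x).
Proof. by move=> aP aQ x y z [? ?] [? ?] [? ?]; split; [apply: aP|apply: aQ]. Qed.

Lemma helly1_seq (I : eqType) (s : seq I) (P : I -> int -> Prop) :
  (forall i, affine1 (P i)) ->
  {in s &, forall i j, exists x, P i x /\ P j x} ->
  exists x, {in s, forall i, P i x}.
Proof.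
move=> aP hP.
suff gen : forall Q, affine1 Q -> (exists x, Q x) ->
    {in s, forall i, exists x, Q x /\ P i x} ->
    exists x, Q x /\ {in s, forall i, P i x}.
  have [||i si|x [_ h]] := gen (fun=> True); last by exists x.
  - by [].
  - by exists 0.
  - by have [x [? _]] := hP i i si si; exists x.
elim: s hP => [|a s IH] hP Q aQ [x q] hQ; first by exists x.
have sub i : i \in s -> i \in a :: s by rewrite inE orbC => ->.
have ha : a \in a :: s by rewrite inE eqxx.
have [|||i si|x' [[q' pa] h]] := IH _ (fun x => Q x /\ P a x).
- by move=> i j /sub si /sub sj; exact: hP.
- exact: affine1_and.
- exact: hQ.
- have [|||x' [? ? ?]] := helly1 aQ (aP a) (aP i); last by exists x'.
  + by apply: hP => //; apply: sub.
  + by apply: hQ; apply: sub.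
  + exact: hQ.
- by exists x'; split=> // i; rewrite inE => /predU1P[->|/h].
Qed.

End Helly.

(** * Reduction of the knapsack equation to bounded exponents *)

Section Knapsack.
Variable T : finType.
Implicit Types (s a : {perm T}) (x c d : T).

(** Helly needs exponents from all of Z. The residue modulo the order is nonnegative, so taking its
    absolute value loses nothing. *)
Definition zpow s (z : int) : {perm T} := (s ^+ `|(z %% #[s]%g)%Z|)%g.

Lemma zpow_nat s (n : nat) : zpow s n = (s ^+ n)%g.
Proof. by rewrite /zpow modz_nat absz_nat expg_mod_order. Qed.

Lemma zpowD s y z x : zpow s (y + z)%R x = zpow s z (zpow s y x).
Proof.
rewrite -permM; congr (fun_of_perm _ x); rewrite /zpow -expgD.
have o0 : (#[s]%g : int) != 0%R by rewrite -lt0n order_gt0.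
rewrite -[LHS]expg_mod_order -[RHS]expg_mod_order; congr (_ ^+ _)%g.
apply/eqP; rewrite -eqz_nat -!modz_nat PoszD.
by rewrite !gez0_abs ?modz_ge0 // modz_mod modzDm.
Qed.

Definition agrees a a1 a2 (i j : int) x := zpow a2 j (zpow a1 i x) = a x.

Definition agrees_on_orbit a a1 a2 c (i j : int) :=
  forall k, agrees a a1 a2 i j ((a1 ^+ k)%g c).

Lemma affine1_agrees a a1 a2 i x : affine1 (fun j => agrees a a1 a2 i j x).
Proof.
move=> j j' j'' h h' h''; rewrite /agrees.
have -> : (j - j' + j'' = j + (- j' + j''))%R by ring.
rewrite zpowD h -[in LHS]h' -zpowD.
have -> : (j' + (- j' + j'') = j'')%R by ring.
exact: h''.
Qed.

(** Let z = a1^(i - i') x, a point of the same cycle. The third solution takes z to a z. So does the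
    second, by way of a1^i' z = a1^i x; hence a2^(j - j') takes a z to a2^j (a1^i x), which is a x
    by the first. *)
Lemma affine2_agrees a a1 a2 c : affine2 (agrees_on_orbit a a1 a2 c).
Proof.
move=> i j i' j' i'' j'' h h' h'' k; rewrite /agrees.
set x := (a1 ^+ k)%g c; set z := zpow a1 (i - i')%R x.
have [p ze] : exists p, z = (a1 ^+ p)%g c by eexists; rewrite /z /x -permM -expgD.
have e1 : zpow a1 i' z = zpow a1 i x by rewrite -zpowD; congr (zpow _ _ _); ring.
rewrite (zpowD a1) -/z.
have -> : (j - j' + j'' = j'' + (j - j'))%R by ring.
rewrite zpowD; have := h'' p; rewrite /agrees -ze => ->.
have := h' p; rewrite /agrees -ze e1 => <-.
rewrite -zpowD; have -> : (j' + (j - j') = j)%R by ring.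
exact: h.
Qed.

Lemma period s x : exists2 l, 0 < l <= #|T| & (s ^+ l)%g x = x.
Proof.
exists (fingraph.order s x); first by rewrite fingraph.order_gt0 max_card.
by rewrite permX iter_order //; apply: perm_inj.
Qed.

Lemma expg_modn_period s x l i : (s ^+ l)%g x = x -> (s ^+ (i %% l))%g x = (s ^+ i)%g x.
Proof.
move=> h; rewrite [in RHS](divn_eq i l) expgD permM; congr (fun_of_perm _ _).
by rewrite mulnC expgM permX; elim: (i %/ l) => //= k <-.
Qed.

Lemma expg_fix_mul s x l k : (s ^+ l)%g x = x -> (s ^+ (l * k))%g x = x.
Proof. by move=> h; rewrite expgM permX; elim: k => //= k ->. Qed.

Lemma expg_fix_orbit s c l k : (s ^+ l)%g c = c ->
  (s ^+ l)%g ((s ^+ k)%g c) = (s ^+ k)%g c.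
Proof. by move=> h; rewrite -permM -expgD addnC expgD permM h. Qed.

(** The exponent of [a1] may exceed [N] and is therefore given by two digits in base [N.+1]. The
    digits depend only on the three cycles, whereas [j] may also depend on the two points. *)
Lemma knapsackP a a1 a2 N : #|T| ^ 2 <= N.+1 ->
  (exists i j, a = (a1 ^+ i * a2 ^+ j)%g) <->
  forall c1 c2 c3, exists i1 i2, [/\ i1 <= N, i2 <= N &
    forall c d k l, c \in [:: c1; c2; c3] -> d \in [:: c1; c2; c3] ->
      k <= N -> l <= N ->
    exists2 j, j <= N &
      (a1 ^+ (i1 + N.+1 * i2) * a2 ^+ j)%g ((a1 ^+ k)%g c) = a ((a1 ^+ k)%g c) /\
      (a1 ^+ (i1 + N.+1 * i2) * a2 ^+ j)%g ((a1 ^+ l)%g d) = a ((a1 ^+ l)%g d)].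
Proof.
move=> hN; split=> [[i [j e]] c1 c2 c3|h].
  have [l1 /andP[l10 l1T] e1] := period a1 c1.
  have [l2 /andP[l20 l2T] e2] := period a1 c2.
  have [l3 /andP[l30 l3T] e3] := period a1 c3.
  pose L := l1 * l2 * l3.
  have L0 : 0 < L by rewrite !muln_gt0 l10 l20.
  (* For t = #|T|, L <= t^3 <= t^4 <= (N + 1)^2. *)
  have LN : L <= N.+1 ^ 2.
    apply: (@leq_trans (#|T| * #|T| * #|T|)); first by rewrite !leq_mul.
    have : 0 < #|T| by lia.
    by move: hN; rewrite -!mulnn; nia.
  exists ((i %% L) %% N.+1), ((i %% L) %/ N.+1).
  have iL : i %% L < N.+1 ^ 2 by apply: leq_trans LN; rewrite ltn_mod.
  split; first by rewrite -ltnS ltn_mod.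
    by rewrite -ltnS ltn_divLR // mulnn.
  rewrite addnC mulnC -divn_eq => c d k l hc hd _ _.
  have fix_L b p : b \in [:: c1; c2; c3] -> (a1 ^+ L)%g ((a1 ^+ p)%g b) = (a1 ^+ p)%g b.
    move=> hb; apply: expg_fix_orbit; move: hb; rewrite !inE => /or3P[]/eqP->.
    - by rewrite /L -mulnA expg_fix_mul.
    - by rewrite /L -mulnA mulnCA expg_fix_mul.
    - by rewrite /L mulnC expg_fix_mul.
  set x := (a1 ^+ k)%g c; set y := (a1 ^+ l)%g d.
  have [u /andP[u0 uT] eu] := period a2 ((a1 ^+ i)%g x).
  have [v /andP[v0 vT] ev] := period a2 ((a1 ^+ i)%g y).
  exists (j %% (u * v)).
    rewrite -ltnS; apply: leq_trans hN; rewrite -mulnn.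
    by apply: leq_trans (leq_mul uT vT); rewrite ltn_mod muln_gt0 u0.
  rewrite e !permM !(expg_modn_period i (fix_L _ _ _)) //.
  split; rewrite -/x -/y expg_modn_period //.
    exact: expg_fix_mul.
  by rewrite mulnC expg_fix_mul.
suff [i [j hij]] : exists i j, {in enum T, forall c, agrees_on_orbit a a1 a2 c i j}.
  exists `|(i %% #[a1]%g)%Z|, `|(j %% #[a2]%g)%Z|; apply/permP => x.
  have := hij x (mem_enum _ _) 0; rewrite /agrees expg0 perm1 => <-.
  by rewrite permM.
apply: helly2_seq => [c|c1 c2 c3 _ _ _]; first exact: affine2_agrees.
have [i1 [i2 [_ _ hi]]] := h c1 c2 c3; set i := i1 + _ in hi.
have TN : #|T| <= N.+1 by apply: leq_trans hN; rewrite -mulnn; case: #|T| => // t; nia.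
(* Exponents up to [N] reach every point of a cycle, whose length is at most #|T| <= N + 1. *)
pose pts := [seq (a1 ^+ k)%g c | c <- [:: c1; c2; c3], k <- iota 0 N.+1].
have ptsP c k : c \in [:: c1; c2; c3] -> (a1 ^+ k)%g c \in pts.
  move=> hc; have [l /andP[l0 lT] el] := period a1 c.
  rewrite -(expg_modn_period _ el); apply: allpairs_f => //.
  by rewrite mem_iota add0n (leq_trans _ TN) // (leq_trans _ lT) // ltn_mod.
have [|x y|j hj] := @helly1_seq T pts (fun x j => agrees a a1 a2 i j x).
- by move=> x; apply: affine1_agrees.
- move=> /allpairsP[[c k] [hc hk ->]] /allpairsP[[d l] [hd hl ->]].
  move: hk hl; rewrite !mem_iota !add0n !ltnS => hk hl.
  have [j _ [h1 h2]] := hi c d k l hc hd hk hl.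
  by exists j; rewrite /agrees !zpow_nat; split; rewrite -?h1 -?h2 [in RHS]permM.
- by exists i, j; split=> k; apply: hj; apply: ptsP; rewrite !inE eqxx ?orbT.
Qed.

End Knapsack.

(** * Programs moving heads over the input *)

Inductive test := AtStart | AtEnd | OnTrue.

Definition cell := (bool * option bool)%type.

Definition check (t : test) (x : cell) : bool :=
  match t with
  | AtStart => x.1
  | AtEnd => x.2 == None
  | OnTrue => x.2 == Some true
  end.

Definition cell_at (w : seq bool) (p : nat) : cell := (p == 0, onth w p).

(* Register [r] is a head on a copy of the input; its value is its position, kept
   between 0 and the length of the input. [Mov r true] moves it to the right. *)
Inductive cmd :=
  | Mov of nat & bool
  | Seq of cmd & cmd
  | Cond of nat & test & cmd & cmd
  | Until of nat & test & cmd.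

Definition shift (w : seq bool) (r : nat) (d : bool) (s : nat -> nat) : nat -> nat :=
  fun i => if i == r then if d then minn (size w) (s i).+1 else (s i).-1
           else s i.

(** Control points become machine states, hence a finite type. In [Cond] and [Until] the point
    [None] is the test. Leaving the command is not a point but the outer [None] of
    [option (point c)]. *)
Fixpoint point (c : cmd) : finType :=
  match c with
  | Mov _ _ => unit
  | Seq a b => (point a + point b)%type
  | Cond _ _ a b => option (point a + point b)%type
  | Until _ _ a => option (point a)
  end.

Fixpoint entry (c : cmd) : point c :=
  match c with
  | Mov _ _ => tt
  | Seq a _ => inl (entry a)
  | Cond _ _ _ _ => None
  | Until _ _ _ => None
  end.

Definition relabel (P Q : Type) (f : option P -> Q)
    (i : nat * (cell -> option P * option bool)) :
    nat * (cell -> Q * option bool) :=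
  (i.1, fun x => (f (i.2 x).1, (i.2 x).2)).

(** In a loop, the exit [None] of the body is relabelled [Some None], which is the test of the
    loop. *)
Fixpoint instr (c : cmd) :
    point c -> nat * (cell -> option (point c) * option bool) :=
  match c with
  | Mov r d => fun _ => (r, fun _ => (None, Some d))
  | Seq a b => fun q =>
      match q with
      | inl q => relabel (fun q' =>
          Some (if q' is Some q1 then inl q1 else inr (entry b))) (instr q)
      | inr q => relabel (omap inr) (instr q)
      end
  | Cond r t a b => fun q =>
      match q with
      | None => (r, fun x =>
          (Some (Some (if check t x then inl (entry a) else inr (entry b))), None))
      | Some (inl q) => relabel (omap (fun q' => Some (inl q'))) (instr q)
      | Some (inr q) => relabel (omap (fun q' => Some (inr q'))) (instr q)
      end
  | Until r t a => fun q =>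
      match q with
      | None => (r, fun x => (if check t x then None else Some (Some (entry a)), None))
      | Some q => relabel (fun q' => Some q') (instr q)
      end
  end.

Definition next (w : seq bool) (c : cmd) (q : point c) (s : nat -> nat) :
    option (point c) * (nat -> nat) :=
  let: (r, f) := instr q in
  let: (q', m) := f (cell_at w (s r)) in
  (q', if m is Some d then shift w r d s else s).

(** Register contents are compared pointwise, so that no functional extensionality is needed. *)
Inductive reach (w : seq bool) (c : cmd) :
    point c -> (nat -> nat) -> nat -> (nat -> nat) -> Prop :=
  | ReachExit q s s' :
      (next w q s).1 = None -> (next w q s).2 =1 s' -> reach w q s 1 s'
  | ReachStep q q1 s s1 t s' :
      (next w q s).1 = Some q1 -> (next w q s).2 =1 s1 ->
      reach w q1 s1 t s' -> reach w q s t.+1 s'.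

Definition runs (w : seq bool) (c : cmd) (s : nat -> nat) (T : nat) (s' : nat -> nat) :=
  exists2 t, t <= T & reach w (entry c) s t s'.

Lemma next_relabel w c c' (q : point c) (q' : point c')
    (f : option (point c) -> option (point c')) s :
  instr q' = relabel f (instr q) ->
  next w q' s = (f (next w q s).1, (next w q s).2).
Proof. by rewrite /next => ->; case: (instr q) => r g /=; case: (g _). Qed.

Lemma reach_omap w c c' (g : point c -> point c') :
  (forall q, instr (g q) = relabel (omap g) (instr q)) ->
  forall q s t s', reach w q s t s' -> reach w (g q) s t s'.
Proof.
move=> hg q s t s'; elim=> {q s t s'} [q s s'|q q1 s s1 t s'] e1 e2.
- by apply: ReachExit; rewrite (next_relabel _ _ (hg q)) /= ?e1.
- by move=> _; apply: ReachStep; rewrite (next_relabel _ _ (hg q)) /= ?e1.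
Qed.

Lemma next_seq w a b (q : point a) s :
  next w (inl q : point (Seq a b)) s =
  (Some (if (next w q s).1 is Some q1 then inl q1 else inr (entry b)),
   (next w q s).2).
Proof.
exact: (@next_relabel w a (Seq a b) q (inl q)
  (fun q' => Some (if q' is Some q1 then inl q1 else inr (entry b)))).
Qed.

Lemma next_until w r t a (q : point a) s :
  next w (Some q : point (Until r t a)) s =
  (Some (next w q s).1, (next w q s).2).
Proof. exact: (@next_relabel w a (Until r t a) q (Some q) (fun q' => Some q')). Qed.

Lemma reach_seq w a b (q : point a) s t s' t' s'' :
  reach w q s t s' -> reach w (entry b) s' t' s'' ->
  reach w (inl q : point (Seq a b)) s (t + t') s''.
Proof.
move=> h /(@reach_omap w b (Seq a b) inr (fun=> erefl)) hb; elim: h hb => {q s t s'} [q s s'|q q1 s s1 t s'] e1 e2.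
- by rewrite add1n => hb; apply: ReachStep hb; rewrite next_seq /= ?e1.
- move=> _ IH /IH hb.
  by rewrite addSn; apply: ReachStep hb; rewrite next_seq /= ?e1.
Qed.

Lemma runs_mov w r d s s' : shift w r d s =1 s' -> runs w (Mov r d) s 1 s'.
Proof. by move=> h; exists 1 => //; apply: ReachExit. Qed.

Lemma runs_seq w a b s T s' T' s'' U :
  runs w a s T s' -> runs w b s' T' s'' -> T + T' <= U ->
  runs w (Seq a b) s U s''.
Proof.
move=> [t tT ra] [t' tT' rb] TU; exists (t + t'); first by lia.
exact: reach_seq ra rb.
Qed.

Lemma runs_cond w r t a b s T s' U :
  runs w (if check t (cell_at w (s r)) then a else b) s T s' -> T < U ->
  runs w (Cond r t a b) s U s'.
Proof.
move=> [k kT h] TU; exists k.+1; first by lia.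
apply: (@ReachStep _ (Cond r t a b) None _ s s) => //.
case: ifP h => _ h.
  exact: (@reach_omap w a (Cond r t a b) (fun q => Some (inl q)) (fun=> erefl)) h.
exact: (@reach_omap w b (Cond r t a b) (fun q => Some (inr q)) (fun=> erefl)) h.
Qed.

Lemma runs_until_stop w r t a s s' :
  check t (cell_at w (s r)) -> s =1 s' -> runs w (Until r t a) s 1 s'.
Proof.
by move=> h e; exists 1 => //; apply: ReachExit; rewrite /next //= h.
Qed.

Lemma runs_until_loop w r t a s T s' T' s'' U :
  ~~ check t (cell_at w (s r)) -> runs w a s T s' ->
  runs w (Until r t a) s' T' s'' -> T + T' < U ->
  runs w (Until r t a) s U s''.
Proof.
move=> /negbTE h [k kT ra] [k' kT' rb] TU; exists (k + k').+1; first by lia.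
apply: (@ReachStep _ (Until r t a) None (Some (entry a)) _ s) => //.
  by rewrite /next /= h.
move: (entry a) ra => q ra {h kT}.
elim: ra rb => {q s k s'} [q s s'|q q1 s s1 k s'] e1 e2.
- by rewrite add1n => hb; apply: ReachStep hb; rewrite next_until /= ?e1.
- move=> _ IH /IH hb.
  by rewrite addSn; apply: ReachStep hb; rewrite next_until /= ?e1.
Qed.

(** * Simulation by a Turing machine *)

Fixpoint regs (c : cmd) : nat :=
  match c with
  | Mov r _ => r
  | Seq a b => maxn (regs a) (regs b)
  | Cond r _ a b => maxn r (maxn (regs a) (regs b))
  | Until r _ a => maxn r (regs a)
  end.

Lemma instr_regs c (q : point c) : (instr q).1 <= regs c.
Proof.
elim: c q => [r d q|a IHa b IHb [q|q]|r t a IHa b IHb [[q|q]|]|r t a IHa [q|]] //=;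
  have := IHa; try have := IHb; do ?[move=> /(_ q)]; rewrite ?leq_max ?leqnn ?orbT //.
all: try by move=> ? ->; rewrite ?orbT.
all: try by move=> -> ; rewrite ?orbT.
all: try by move=> -> *; rewrite ?orbT.
Qed.

Definition symbol := option cell.

(** Enforces the clamping of [shift] from the symbol under the head alone: the first cell and the
    cell after the input are marked. *)
Definition guarded (x : cell) (m : option bool) : move :=
  match m with
  | None => Stay
  | Some true => if x.2 == None then Stay else MoveRight
  | Some false => if x.1 then Stay else MoveLeft
  end.

Lemma iter_halted (M : TM) (cf : config M) b k :
  tm_verdict (cfg_state cf) = Some b -> iter k (@step M) cf = cf.
Proof. by move=> h; elim: k => // k IH; rewrite iterS IH /step h. Qed.

Section Simulation.
Variable c : cmd.

(* [inl (Some first)]: copying the input to every tape, [first] telling whether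
   the heads are on cell 0; [inl None]: rewinding; [inr (inl b)]: halted with
   verdict [b]; [inr (inr q)]: executing [c] at [q]. *)
Definition sim_state : finType :=
  (option bool + (bool + option (point c)))%type.

(** During execution the heads stay on marked cells, so the default [(true, None)] for a blank is
    never met. The verdict asks whether head 0 is off the first cell, that is, whether register 0 is
    nonzero. *)
Definition sim_trans (q : sim_state)
    (o : {ffun 'I_(regs c).+1 -> symbol}) :
    sim_state * ('I_(regs c).+1 -> symbol * move) :=
  match q with
  | inl (Some first) =>
      if o ord0 is Some (_, Some b)
      then (inl (Some false), fun=> (Some (first, Some b), MoveRight))
      else (inl None, fun=> (Some (first, None), Stay))
  | inl None =>
      if o ord0 is Some (true, _)
      then (inr (inr (Some (entry c))), fun i => (o i, Stay))
      else (inl None, fun i => (o i, MoveLeft))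
  | inr (inl b) => (q, fun i => (o i, Stay))
  | inr (inr None) =>
      (inr (inl (if o ord0 is Some (b, _) then ~~ b else true)),
       fun i => (o i, Stay))
  | inr (inr (Some p)) =>
      let: (r, f) := instr p in
      let x := odflt (true, None) (o (inord r)) in
      let: (p', m) := f x in
      (inr (inr p'),
       fun i => (o i, if val i == r then guarded x m else Stay))
  end.

Definition sim_bit (b : bool) : symbol := Some (false, Some b).

Lemma sim_bit_inj : injective sim_bit.
Proof. by move=> b b' []. Qed.

Definition sim : TM := @MkTM (regs c) sim_state symbol (inl (Some true))
  (fun q => if q is inr (inl b) then Some b else None)
  None sim_bit sim_bit_inj (fun=> isT) sim_trans.

Variable w : seq bool.
Let n := size w.

Definition marked (p : nat) : symbol := Some (cell_at w p).

Fixpoint below (p : nat) : seq symbol :=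
  if p is p'.+1 then marked p' :: below p' else [::].

Definition tape_at (p : nat) : tape symbol :=
  Tape (below p) (marked p) (map marked (iota p.+1 (n - p))).

(** Behind the head the cells are already marked; [rest] is the uncopied input on tape 0 and empty
    on the other tapes. *)
Definition copying (p : nat) (rest : seq bool) : tape symbol :=
  let r := map sim_bit rest in Tape (below p) (head None r) (behead r).

Definition positioned (cf : config sim) (q : sim_state) (s : nat -> nat) :=
  cfg_state cf = q /\ forall i, cfg_tapes cf i = tape_at (s (val i)).

Lemma tape_at_right p : p < n ->
  write_move None (tape_at p) (marked p, MoveRight) = tape_at p.+1.
Proof.
move=> pn; rewrite /tape_at /=.
by have -> : n - p = (n - p.+1).+1 by lia.
Qed.

Lemma tape_at_left p : 0 < p <= n ->
  write_move None (tape_at p) (marked p, MoveLeft) = tape_at p.-1.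
Proof.
case: p => // p /= pn; rewrite /tape_at /=.
by have -> : n - p = (n - p.+1).+1 by lia.
Qed.

Lemma step_copying (cf : config sim) p : p <= n ->
  cfg_state cf = inl (Some (p == 0)) :> sim_state ->
  (forall i, cfg_tapes cf i = copying p (if i == ord0 then drop p w else [::])) ->
  if p < n then
    cfg_state (step cf) = inl (Some (p.+1 == 0)) :> sim_state /\
    (forall i, cfg_tapes (step cf) i =
       copying p.+1 (if i == ord0 then drop p.+1 w else [::]))
  else positioned (step cf) (inl None) (fun=> n).
Proof.
case: cf => q tp /= pn -> ht; rewrite /step /= ffunE.
case: ltnP => hp.
  rewrite ht eqxx (drop_nth false) //=; split=> // i; rewrite ht.
  have mk : Some (p == 0, Some (nth false w p)) = marked p.
    by rewrite /marked /cell_at onthE (nth_map false).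
  by case: eqP => _ /=; rewrite ?(drop_nth false hp) /= mk.
have e : p = size w by lia.
have {}ht i : tp i = copying n [::] by rewrite ht e drop_size if_same.
rewrite ht /=; split=> // i /=; rewrite ht /copying /tape_at subnn /=.
by rewrite /marked /cell_at onthE nth_default ?size_map // e.
Qed.

Lemma copy_phase : exists2 t, t <= n.+1 &
  positioned (iter t (@step sim) (init_config sim w)) (inl None) (fun=> n).
Proof.
exists n.+1 => //; rewrite iterS.
suff: forall p, p <= n ->
    let cf := iter p (@step sim) (init_config sim w) in
    cfg_state cf = inl (Some (p == 0)) :> sim_state /\
    forall i, cfg_tapes cf i = copying p (if i == ord0 then drop p w else [::]).
  move=> /(_ n (leqnn n)) [h1 h2].
  by have := step_copying (leqnn n) h1 h2; rewrite ltnn.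
elim=> [_|p IH pn] /=.
  by split=> // i; rewrite drop0; case: eqP.
have [h1 h2] := IH (ltnW pn).
by have := step_copying (ltnW pn) h1 h2; rewrite pn.
Qed.

Lemma rewind_phase cf p : p <= n -> positioned cf (inl None) (fun=> p) ->
  exists2 t, t <= p.+1 &
  positioned (iter t (@step sim) cf) (inr (inr (Some (entry c)))) (fun=> 0).
Proof.
elim: p cf => [|p IH] [q tp] pn [/= -> ht].
  exists 1 => //; split; rewrite /= /step /= ffunE ht //= => i.
  by rewrite ffunE ht.
have [|t tp' h] := IH (step (Config (inl None : tm_state sim) tp)) (ltnW pn).
  split; rewrite /step /= ffunE ht //= => i.
  by rewrite ffunE ht; apply: (@tape_at_left p.+1).
by exists t.+1 => //; rewrite iterSr.
Qed.

Lemma guarded_at p m : p <= n ->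
  write_move None (tape_at p) (marked p, guarded (cell_at w p) m) =
  tape_at (if m is Some d then if d then minn n p.+1 else p.-1 else p).
Proof.
move=> pn; case: m => [[]|] //=; last first.
  by case: eqP => [->//|p0]; apply: tape_at_left; lia.
have -> : (onth w p == None) = (n <= p).
  rewrite onthE; case: leqP => h; last by rewrite (nth_map false).
  by rewrite nth_default // size_map.
case: leqP => h; first by have -> : minn n p.+1 = p by lia.
by rewrite (minn_idPr h); apply: tape_at_right.
Qed.

Lemma shift_le r d s : (forall i, s i <= n) -> forall i, shift w r d s i <= n.
Proof.
move=> h i; rewrite /shift -/n; case: eqP => // _.
by case: d; have := h i; lia.
Qed.

Lemma step_run cf (q : point c) s : (forall i, s i <= n) ->
  positioned cf (inr (inr (Some q))) s ->
  positioned (step cf) (inr (inr (next w q s).1)) (next w q s).2.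
Proof.
case: cf => ? tp hs [/= -> ht]; rewrite /step /= /next.
have := instr_regs q; case: (instr q) => r f /= hr.
rewrite ffunE ht inordK //=.
case: (f _) => q' m /=; split=> // i /=.
rewrite ffunE ht /=; case: eqP => [->|ne].
  apply: etrans (guarded_at m (hs r)) _.
  by case: m => // d; rewrite /shift eqxx.
by case: m => // d; rewrite /shift; case: eqP ne.
Qed.

Lemma next_le (q : point c) s : (forall i, s i <= n) -> forall i, (next w q s).2 i <= n.
Proof.
move=> hs; rewrite /next; case: (instr q) => r f; case: (f _) => q' [d|] //=.
exact: shift_le.
Qed.

Lemma run_phase (q : point c) s t s' cf : (forall i, s i <= n) ->
  reach w q s t s' -> positioned cf (inr (inr (Some q))) s ->
  positioned (iter t (@step sim) cf) (inr (inr None)) s'.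
Proof.
move=> hs h; elim: h cf hs => {q s t s'} [q s s'|q q1 s s1 t s'] e1 e2.
  move=> cf hs /(step_run hs) [/= h1 h2]; split; first by rewrite h1 e1.
  by move=> i; rewrite h2 e2.
move=> _ IH cf hs /(step_run hs) [/= h1 h2]; rewrite -iterS iterSr; apply: IH.
  by move=> i; rewrite -e2; apply: next_le.
by split; [rewrite h1 e1|move=> i; rewrite h2 e2].
Qed.

(** Copying and rewinding take at most n + 1 steps each, and one step turns the exit into a verdict.
    Halted configurations stay put, so an upper bound serves as the number of steps. *)
Lemma sim_verdict T s' : runs w c (fun=> 0) T s' ->
  tm_verdict (cfg_state (iter (T + n.*2 + 3) (@step sim) (init_config sim w))) =
  Some (s' 0 != 0).
Proof.
have [t1 le1 h1] := copy_phase.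
have [t2 le2 h2] := rewind_phase (leqnn _) h1.
move=> [t3 le3 /(@run_phase _ _ _ _ _ (fun=> leq0n _)) /(_ h2)].
rewrite -!iterD -addnA; set cf := iter _ _ _ => h3.
have h4 : tm_verdict (cfg_state (step cf)) = Some (s' 0 != 0).
  by move: cf h3 => [? tp] [/= -> ht]; rewrite /step /= ffunE ht.
have -> : T + n.*2 + 3 = (T + n.*2 + 3 - (t3 + (t2 + t1)).+1) + (t3 + (t2 + t1)).+1.
  by lia.
by rewrite iterD iterS -/cf (iter_halted _ h4).
Qed.

End Simulation.

(** * Polynomial time bounds *)

Definition polynomial (f : nat -> nat) : Prop :=
  exists p : {poly nat}, forall k, p.[k]%R = f k.

Lemma polynomial_const a : polynomial (fun=> a).
Proof. by exists (a%:P)%R => k; rewrite hornerC. Qed.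

Lemma polynomial_id : polynomial id.
Proof. by exists 'X%R => k; rewrite hornerX. Qed.

Lemma polynomial_add f g : polynomial f -> polynomial g ->
  polynomial (fun k => f k + g k).
Proof. by move=> [p hp] [q hq]; exists (p + q)%R => k; rewrite hornerD hp hq. Qed.

Lemma polynomial_mul f g : polynomial f -> polynomial g ->
  polynomial (fun k => f k * g k).
Proof. by move=> [p hp] [q hq]; exists (p * q)%R => k; rewrite hornerM hp hq. Qed.

Lemma program_polynomial_time c f (L : seq bool -> Prop) :
  polynomial f ->
  (forall w, exists s', runs w c (fun=> 0) (f (size w)) s' /\ (s' 0 != 0 <-> L w)) ->
  polynomial_time L.
Proof.
move=> [p hp] hc; exists (sim c), (p + ('X + 'X) + 3%:P)%R => w.
have [s' [hs hL]] := hc w; exists (s' 0 != 0); split=> //.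
have -> : (p + ('X + 'X) + 3%:P).[size w]%R = f (size w) + (size w).*2 + 3.
  by rewrite !hornerD hornerX hornerC hp -addnn.
exact: sim_verdict hs.
Qed.

(** * Bounded recursion *)

Definition upd (s : nat -> nat) (r v : nat) : nat -> nat :=
  fun i => if i == r then v else s i.

Definition bounded (w : seq bool) (s : nat -> nat) := forall i, s i <= size w.

Definition rewind (r : nat) : cmd := Until r AtStart (Mov r false).

Definition pour (b : bool) (r d : nat) : cmd :=
  Until r AtStart (Seq (Mov r false) (Mov d b)).

Definition replace (r d : nat) : cmd := Seq (rewind d) (pour true r d).

(** Reading a register empties it, so the value goes both to [d] and to [d.+1], and the second copy
    restores [r]. *)
Definition copy (r d : nat) : cmd :=
  Seq (Seq (rewind d) (rewind d.+1))
  (Seq (Until r AtStart (Seq (Mov r false) (Seq (Mov d true) (Mov d.+1 true))))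
       (pour true d.+1 r)).

Ltac pointwise :=
  let i := fresh "i" in
  move=> i; rewrite /shift /upd; repeat (case: eqP => ? //; subst); try lia.

Lemma runs_rewind w r s s' T : s' =1 upd s r 0 -> 2 * s r < T ->
  runs w (rewind r) s T s'.
Proof.
move=> hs' hT; have [t [ht hr]] : exists t, t <= T /\ runs w (rewind r) s t s'; last first.
  by case: hr => k kt h; exists k => //; lia.
exists (2 * s r).+1; split=> // {T hT}.
move: {2 3}(s r) (erefl (s r)) => v; elim: v s hs' => [|v IH] s hs' hv.
  apply: runs_until_stop => /=; first by rewrite hv.
  by move=> i; rewrite hs' /upd; case: eqP => [->|].
apply: (runs_until_loop (T := 1) (s' := shift w r false s) (T' := (2 * v).+1)).
- by rewrite /= hv.
- exact: runs_mov.
- apply: IH; last by rewrite /shift eqxx hv.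
  by move=> i; rewrite hs'; move: i; pointwise.
- by lia.
Qed.

Lemma runs_pour w b r d s s' T : r != d -> bounded w s ->
  s' =1 upd (upd s r 0) d (if b then minn (size w) (s d + s r) else s d - s r) ->
  3 * s r < T -> runs w (pour b r d) s T s'.
Proof.
move=> rd; move e: (s r) => v; elim: v s T e => [|v IH] s T hv hb hs' hT.
  have [k kT h] : runs w (pour b r d) s 1 s'; last by exists k => //; lia.
  apply: runs_until_stop => /=; first by rewrite hv.
  move=> i; rewrite hs'; move: i; move: (hb d); rewrite addn0 subn0 => hd.
  by case: b {hs'}; pointwise.
pose s1 := shift w d b (shift w r false s).
apply: (runs_until_loop (T := 2) (s' := s1) (T' := (3 * v).+1)) => //=.
- by rewrite hv.
- by apply: runs_seq; [exact: runs_mov|exact: runs_mov|].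
- apply: IH; rewrite ?/s1.
  + by rewrite /shift (negbTE rd) eqxx hv.
  + move=> i; rewrite /shift; have := hb i; have := hb d; have := hb r.
    by case: (b); repeat (case: eqP => ? //; subst); lia.
  + move=> i; rewrite hs' /upd /shift.
    have := hb d.
    by case: (b) => hd; repeat (case: eqP => ? //; subst); lia.
  + by lia.
- by lia.
Qed.

Lemma runs_replace w r d s s' T : r != d -> bounded w s ->
  s' =1 upd (upd s r 0) d (s r) -> 5 * size w + 2 <= T ->
  runs w (replace r d) s T s'.
Proof.
move=> rd hb hs' hT; have hd := hb d; have hr := hb r.
apply: (@runs_seq _ _ _ _ (2 * size w + 1) (upd s d 0) (3 * size w + 1)); last by lia.
  by apply: runs_rewind => //; lia.
apply: runs_pour => //; first by move=> i; rewrite /upd; case: eqP.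
  by move=> i; rewrite hs' /upd eqxx (negbTE rd); repeat (case: eqP => ? //; subst); lia.
by rewrite /upd (negbTE rd); lia.
Qed.

Lemma runs_copy w r d s s' T : r < d -> bounded w s ->
  s' =1 upd (upd s d.+1 0) d (s r) -> 11 * size w + 4 <= T ->
  runs w (copy r d) s T s'.
Proof.
move=> rd hb hs' hT; have hd := hb d; have hr := hb r; have hd1 := hb d.+1.
pose s1 := upd (upd s d 0) d.+1 0.
pose s2 := upd (upd (upd s d (s r)) d.+1 (s r)) r 0.
apply: (@runs_seq _ _ _ _ (4 * size w + 2) s1 (7 * size w + 2)); last by lia.
  apply: (@runs_seq _ _ _ _ (2 * size w + 1) (upd s d 0) (2 * size w + 1)); last by lia.
    by apply: runs_rewind => //; lia.
  by apply: runs_rewind => //; rewrite /upd; case: eqP; lia.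
apply: (@runs_seq _ _ _ _ (4 * size w + 1) s2 (3 * size w + 1)); last by lia.
  have [k kT h] : runs w (Until r AtStart (Seq (Mov r false) (Seq (Mov d true) (Mov d.+1 true))))
    s1 (4 * s r).+1 s2; last by exists k => //; lia.
  have hs1 : s1 d = s1 d.+1 by rewrite /s1 /upd eqxx; repeat case: eqP => //; lia.
  have e1 : s1 r = s r by rewrite /s1 /upd; repeat case: eqP => //; lia.
  have h2 : s2 =1 upd (upd (upd s1 d (s1 d + s r)) d.+1 (s1 d.+1 + s r)) r 0.
    by rewrite /s2 /s1; pointwise.
  have hle : s1 d + s r <= size w.
    by rewrite /s1 /upd; repeat case: eqP => //; lia.
  move: (s r) s1 e1 hs1 h2 hle => v s1.
  elim: v s1 => [|v IH] s1 e1 hs1 h2 hle.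
    apply: runs_until_stop => /=; first by rewrite e1.
    by move=> i; rewrite h2; move: i; pointwise.
  pose s3 := shift w d.+1 true (shift w d true (shift w r false s1)).
  apply: (runs_until_loop (T := 3) (s' := s3) (T' := (4 * v).+1)) => //=.
  - by rewrite e1.
  - apply: runs_seq; [exact: runs_mov|apply: (@runs_seq _ _ _ _ 1 _ 1 _ 2)|];
      by [exact: runs_mov|].
  - have x1 : s3 r = v by rewrite /s3 /shift eqxx; repeat case: eqP => //; lia.
    have x2 : s3 d = (s1 d).+1.
      by rewrite /s3 /shift eqxx; repeat case: eqP => //; lia.
    have x3 : s3 d.+1 = (s1 d.+1).+1.
      by rewrite /s3 /shift eqxx; repeat case: eqP => //; lia.
    apply: IH; rewrite ?x1 ?x2 ?x3 //; try lia.
    move=> i; rewrite h2 /upd; repeat (case: eqP => ? //; subst); try lia.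
    by rewrite /s3 /shift; repeat (case: eqP => ? //; subst); lia.
  - by lia.
apply: runs_pour; rewrite ?/s2; first by lia.
- by move=> i; rewrite /upd; repeat case: eqP => //.
- move=> i; rewrite hs'; move: i => i; rewrite /upd eqxx.
  by repeat (case: eqP => ? //; subst); lia.
- by rewrite /upd; repeat (case: eqP => ? //; subst); lia.
Qed.

(* [Rec e1 e2] folds [e2] over p = 0, ..., n, where n is the length of the input;
   in [e2], index 0 is p and index 1 the accumulator.  [Wk j k e] is [e] with
   the [k] variables from index [j] on removed from its context. *)
Inductive expr :=
  | Var of nat
  | Cst of bool
  | Plus of expr & expr
  | Minus of expr & expr
  | Bit of expr
  | If of expr & expr & expr
  | Let of expr & expr
  | Rec of expr & expr
  | Wk of nat & nat & expr.

(** Sums and constants are cut off at the input length because registers are. On the empty input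
    even [Cst true] is 0, hence the later assumption that the input is nonempty. *)
Fixpoint den (w : seq bool) (env : seq nat) (e : expr) : nat :=
  match e with
  | Var i => nth 0 env i
  | Cst b => minn (size w) b
  | Plus e1 e2 => minn (size w) (den w env e1 + den w env e2)
  | Minus e1 e2 => den w env e1 - den w env e2
  | Bit e1 => nth false w (den w env e1)
  | If e1 e2 e3 => if den w env e1 == 0 then den w env e3 else den w env e2
  | Let e1 e2 => den w (den w env e1 :: env) e2
  | Rec e1 e2 =>
      foldl (fun a p => den w [:: p, a & env] e2) (den w env e1)
            (iota 0 (size w).+1)
  | Wk j k e1 => den w (take j env ++ drop (j + k) env) e1
  end.

Definition arith (b : bool) (d : nat) (c1 c2 : cmd) : cmd :=
  Seq c1 (Seq c2 (pour b d.+1 d)).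

Definition turn (d : nat) (c : cmd) : cmd := Seq c (replace d.+2 d).

(* [rho] lists the registers holding the variables, [d] receives the value and
   the registers above [d] are scratch space. *)
Fixpoint compile (rho : seq nat) (d : nat) (e : expr) : cmd :=
  match e with
  | Var i => if i < size rho then copy (nth 0 rho i) d else rewind d
  | Cst b => if b then Seq (rewind d) (Mov d true) else rewind d
  | Plus e1 e2 => arith true d (compile rho d e1) (compile rho d.+1 e2)
  | Minus e1 e2 => arith false d (compile rho d e1) (compile rho d.+1 e2)
  | Bit e1 => Seq (compile rho d e1)
      (Cond d OnTrue (Seq (rewind d) (Mov d true)) (rewind d))
  | If e1 e2 e3 => Seq (compile rho d e1)
      (Cond d AtStart (compile rho d e3) (compile rho d e2))
  | Let e1 e2 => Seq (compile rho d e1)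
      (Seq (compile (d :: rho) d.+1 e2) (replace d.+1 d))
  | Rec e1 e2 =>
      let body := turn d (compile [:: d.+1, d & rho] d.+2 e2) in
      Seq (compile rho d e1) (Seq (rewind d.+1) (Seq body
        (Until d.+1 AtEnd (Seq (Mov d.+1 true) body))))
  | Wk j k e1 => compile (take j rho ++ drop (j + k) rho) d e1
  end.

Fixpoint cost (e : expr) (n : nat) : nat :=
  match e with
  | Var _ => 11 * n + 4
  | Cst _ => 2 * n + 2
  | Plus e1 e2 => cost e1 n + cost e2 n + (3 * n + 1)
  | Minus e1 e2 => cost e1 n + cost e2 n + (3 * n + 1)
  | Bit e1 => cost e1 n + (2 * n + 3)
  | If e1 e2 e3 => cost e1 n + (cost e2 n + cost e3 n + 1)
  | Let e1 e2 => cost e1 n + cost e2 n + (5 * n + 2)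
  | Rec e1 e2 => cost e1 n + (2 * n + 2) + (n + 1) * (cost e2 n + (5 * n + 4))
  | Wk _ _ e1 => cost e1 n
  end.

Lemma polynomial_cost e : polynomial (cost e).
Proof.
elim: e => *; rewrite /cost -/cost; do ?[assumption | apply: polynomial_add
  | apply: polynomial_mul | apply: polynomial_const | apply: polynomial_id].
Qed.

(** Registers below [d] hold variables and pending values; those above [d] may end up with anything
    within bounds. *)
Definition evaluates w c d s T v := exists2 s', runs w c s T s' &
  [/\ s' d = v, forall i, i < d -> s' i = s i & bounded w s'].

Lemma evaluates_le w c d s T T' v : T <= T' ->
  evaluates w c d s T v -> evaluates w c d s T' v.
Proof. by move=> h [s' [t tT r] hs]; exists s' => //; exists t => //; lia. Qed.

Lemma evaluates_seq w a b d d' s T v T' v' : d <= d' ->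
  evaluates w a d' s T v ->
  (forall s', s' d' = v -> (forall i, i < d' -> s' i = s i) -> bounded w s' ->
     evaluates w b d s' T' v') ->
  evaluates w (Seq a b) d s (T + T') v'.
Proof.
move=> dd [s1 r1 [e1 f1 b1]] /(_ s1 e1 f1 b1) [s2 r2 [e2 f2 b2]].
exists s2; first exact: runs_seq r1 r2 _.
by split=> // i hi; rewrite f2 // f1 //; lia.
Qed.

Lemma evaluates_runs w c d s T v s' : runs w c s T s' -> s' d = v ->
  (forall i, i < d -> s' i = s i) -> bounded w s' -> evaluates w c d s T v.
Proof. by move=> *; exists s'. Qed.

Lemma evaluates_rewind w d s T : bounded w s -> 2 * size w < T ->
  evaluates w (rewind d) d s T 0.
Proof.
move=> hb hT; have hd := hb d; apply: (@evaluates_runs _ _ _ _ _ _ (upd s d 0)).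
- by apply: runs_rewind => //; lia.
- by rewrite /upd eqxx.
- by move=> i hi; rewrite /upd; case: eqP => //; lia.
- by move=> i; rewrite /upd; case: eqP.
Qed.

Lemma evaluates_mov w d s b v : bounded w s ->
  v = (if b then minn (size w) (s d).+1 else (s d).-1) ->
  evaluates w (Mov d b) d s 1 v.
Proof.
move=> hb ->; apply: (@evaluates_runs _ _ _ _ _ _ (shift w d b s)).
- exact: runs_mov.
- by rewrite /shift eqxx.
- by move=> i hi; rewrite /shift; case: eqP => //; lia.
- exact: shift_le.
Qed.

Lemma evaluates_one w d s T : bounded w s -> 2 * size w + 2 <= T ->
  evaluates w (Seq (rewind d) (Mov d true)) d s T (minn (size w) 1).
Proof.
move=> hb hT; apply: (@evaluates_le _ _ _ _ ((2 * size w).+1 + 1)); first by lia.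
apply: (evaluates_seq (leqnn d)); first exact: evaluates_rewind.
by move=> s' e _ hb'; apply: evaluates_mov; rewrite ?e.
Qed.

Lemma evaluates_pour w b r d s v : d < r -> bounded w s ->
  v = (if b then minn (size w) (s d + s r) else s d - s r) ->
  evaluates w (pour b r d) d s (3 * size w + 1) v.
Proof.
move=> rd hb ->; have hd := hb d; have hr := hb r.
apply: (evaluates_runs (s' := upd (upd s r 0) d _)).
- by apply: runs_pour => //; lia.
- by rewrite /upd eqxx.
- by move=> i hi; rewrite /upd; repeat case: eqP => //; lia.
- by move=> i; have := hb i; rewrite /upd; case: b; repeat case: eqP => //; lia.
Qed.

Lemma evaluates_replace w r d s : d < r -> bounded w s ->
  evaluates w (replace r d) d s (5 * size w + 2) (s r).
Proof.
move=> rd hb; have hr := hb r.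
apply: (evaluates_runs (s' := upd (upd s r 0) d (s r))).
- by apply: runs_replace => //; lia.
- by rewrite /upd eqxx.
- by move=> i hi; rewrite /upd; repeat case: eqP => //; lia.
- by move=> i; have := hb i; rewrite /upd; repeat case: eqP => //; lia.
Qed.

Lemma evaluates_copy w r d s : r < d -> bounded w s ->
  evaluates w (copy r d) d s (11 * size w + 4) (s r).
Proof.
move=> rd hb; have hr := hb r.
apply: (evaluates_runs (s' := upd (upd s d.+1 0) d (s r))).
- by apply: runs_copy => //; lia.
- by rewrite /upd eqxx.
- by move=> i hi; rewrite /upd; repeat case: eqP => //; lia.
- by move=> i; have := hb i; rewrite /upd; repeat case: eqP => //; lia.
Qed.

Lemma evaluates_cond w r t a b d s T v :
  evaluates w (if check t (cell_at w (s r)) then a else b) d s T v ->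
  evaluates w (Cond r t a b) d s (T + 1) v.
Proof.
by move=> [s' h hs]; exists s' => //; apply: runs_cond h _; lia.
Qed.

Lemma check_AtEnd w p : check AtEnd (cell_at w p) = (size w <= p).
Proof.
rewrite /= onthE; case: leqP => h; last by rewrite (nth_map false).
by rewrite nth_default // size_map.
Qed.

Lemma check_OnTrue w p : check OnTrue (cell_at w p) = nth false w p.
Proof.
rewrite /= onthE; case: (leqP (size w) p) => h; last first.
  by rewrite (nth_map false) //; case: (nth _ _ _).
by rewrite !nth_default // size_map.
Qed.

(** A register cannot hold n + 1, so the loop cannot stop after passing n. Instead the body runs
    once for index 0, and each later round is preceded by the test for n and an increment: n + 1
    rounds in all. *)
Lemma evaluates_scan w d s T (f : nat -> nat -> nat) body :
  bounded w s -> s d.+1 = 0 ->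
  (forall s' , bounded w s' -> (forall i, i < d -> s' i = s i) ->
     exists2 s1, runs w body s' T s1 &
       [/\ s1 d = f (s' d) (s' d.+1), s1 d.+1 = s' d.+1,
           forall i, i < d -> s1 i = s i & bounded w s1]) ->
  evaluates w (Seq body (Until d.+1 AtEnd (Seq (Mov d.+1 true) body))) d s
    ((size w + 1) * (T + 2)) (foldl f (s d) (iota 0 (size w).+1)).
Proof.
move=> hb h0 hbody; have [s1 r1 [e1 p1 f1 b1]] := hbody s hb (fun _ _ => erefl).
rewrite h0 in e1 p1.
have loop v : forall s1, size w - s1 d.+1 = v -> s1 d.+1 <= size w ->
    (forall i, i < d -> s1 i = s i) -> bounded w s1 ->
    evaluates w (Until d.+1 AtEnd (Seq (Mov d.+1 true) body)) d s1
      (v * (T + 2) + 1) (foldl f (s1 d) (iota (s1 d.+1).+1 v)).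
  elim: v => [|v IH] {r1 e1 p1 f1 b1}s1 k hle f1 b1.
    exists s1 => //; apply: runs_until_stop => //.
    by rewrite check_AtEnd; lia.
  pose s2 := shift w d.+1 true s1.
  have [||s3 r3 [e3 p3 f3 b3]] := hbody s2.
  - exact: shift_le.
  - by move=> i hi; rewrite /s2 /shift; case: eqP => //; [lia|rewrite f1].
  have s2d : s2 d = s1 d by rewrite /s2 /shift; case: eqP => //; lia.
  have s2d1 : s2 d.+1 = (s1 d.+1).+1 by rewrite /s2 /shift eqxx; lia.
  have [||||s4 r4 [e4 f4 b4]] := IH s3; rewrite ?p3 ?s2d1 //; try lia.
  exists s4.
    apply: (runs_until_loop _ _ r4).
    - by rewrite check_AtEnd; lia.
    - by apply: (runs_seq (runs_mov (s' := s2) _) r3 (leqnn _)).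
    - by lia.
  split=> //.
  - by rewrite e4 e3 p3 s2d s2d1.
  - by move=> i hi; rewrite f4 // f3 // f1.
have [||//|//|s' r' [e' f' b']] := loop (size w) s1; rewrite ?p1 ?subn0 //.
exists s'.
  by apply: (runs_seq r1 r'); lia.
split=> //.
- by rewrite e' e1 p1.
- by move=> i hi; rewrite f' // f1.
Qed.

Lemma evaluates_compile w e rho d s :
  all (fun r => r < d) rho -> bounded w s ->
  evaluates w (compile rho d e) d s (cost e (size w)) (den w (map s rho) e).
Proof.
have agree r (s1 s2 : nat -> nat) k : all (fun r => r < k) r ->
    (forall i, i < k -> s1 i = s2 i) -> map s1 r = map s2 r.
  by move=> /allP h1 h2; apply/eq_in_map => i /h1; exact: h2.
have wide r k k' : k <= k' -> all (fun r => r < k) r -> all (fun r => r < k') r.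
  by move=> kk /allP h; apply/allP => i /h; lia.
elim: e rho d s => [i|b|e1 IH1 e2 IH2|e1 IH1 e2 IH2|e1 IH1|e1 IH1 e2 IH2 e3 IH3
  |e1 IH1 e2 IH2|e1 IH1 e2 IH2|j k e1 IH1] rho d s hr hb.
- rewrite /=; case: ltnP => hi.
    rewrite (nth_map 0) //; apply: evaluates_copy => //.
    by move/allP: hr => /(_ _ (mem_nth 0 hi)).
  by rewrite nth_default ?size_map //; apply: evaluates_rewind => //; lia.
- by case: b => /=; [apply: evaluates_one|rewrite minn0; apply: evaluates_rewind => //; lia].
- rewrite /= -addnA; apply: (evaluates_seq (leqnn d)); first exact: IH1.
  move=> s1 x1 a1 b1; apply: (evaluates_seq (leqnSn d)).
    by apply: IH2; rewrite // (wide _ d).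
  move=> s2 x2 a2 b2; apply: evaluates_pour => //.
  by rewrite x2 (a2 d) // x1 (agree rho s1 s d).
- rewrite /= -addnA; apply: (evaluates_seq (leqnn d)); first exact: IH1.
  move=> s1 x1 a1 b1; apply: (evaluates_seq (leqnSn d)).
    by apply: IH2; rewrite // (wide _ d).
  move=> s2 x2 a2 b2; apply: evaluates_pour => //.
  by rewrite x2 (a2 d) // x1 (agree rho s1 s d).
- rewrite /=; apply: (evaluates_seq (leqnn d)); first exact: IH1.
  move=> s1 x1 a1 b1; rewrite -[X in _ + X]addn1 addnA.
  apply: (@evaluates_le _ _ _ _ (2 * size w + 2 + 1)); first by lia.
  apply: evaluates_cond; rewrite check_OnTrue x1; case hw: (nth _ _ _).
    (* A true bit exists only in a nonempty input, where 1 is not cut off. *)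
    have -> : nat_of_bool true = minn (size w) 1.
      case: (leqP (size w) (den w [seq s i | i <- rho] e1)) hw => h /=; last by lia.
      by rewrite nth_default.
    exact: evaluates_one.
  by apply: evaluates_rewind => //; lia.
- rewrite /=; apply: (evaluates_seq (leqnn d)); first exact: IH1.
  move=> s1 x1 a1 b1; apply: evaluates_cond.
  rewrite /= x1; case: ifP => _.
    rewrite -(agree rho s1 s d) //.
    by apply: evaluates_le (IH3 rho d s1 hr b1); lia.
  rewrite -(agree rho s1 s d) //.
  by apply: evaluates_le (IH2 rho d s1 hr b1); lia.
- rewrite /= -addnA; apply: (evaluates_seq (leqnn d)); first exact: IH1.
  move=> s1 x1 a1 b1; apply: (evaluates_seq (leqnSn d)).
    by apply: (IH2 (d :: rho)); rewrite //= ltnSn (wide _ d).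
  move=> s2 x2 a2 b2; have := evaluates_replace (ltnSn d) b2.
  by rewrite x2 /= x1 (agree rho s1 s d).
- rewrite /= -addnA; apply: (evaluates_seq (leqnn d)); first exact: IH1.
  move=> s1 x1 a1 b1; apply: (evaluates_seq (leqnSn d)).
    by apply: evaluates_rewind => //; lia.
  move=> s2 x2 a2 b2; rewrite -x1 -(a2 d) //.
  apply: (@evaluates_le _ _ _ _ ((size w + 1) * (cost e2 (size w) + (5 * size w + 2) + 2))).
    by rewrite leq_mul2l; lia.
  apply: (evaluates_scan (f := fun a p => den w [:: p, a & map s rho] e2)) => //.
  move=> s3 b3 a3.
  have [|s4 r4 [x4 a4 b4]] := IH2 [:: d.+1, d & rho] d.+2 s3 _ b3.
    by rewrite /= ltnSn leqnSn (wide _ d) //; lia.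
  exists (upd (upd s4 d.+2 0) d (s4 d.+2)).
    have ne : d.+2 != d by lia.
    by apply: runs_seq r4 (runs_replace ne b4 (fun=> erefl) (leqnn _)) _; lia.
  have b42 := b4 d.+2; split.
  - rewrite /upd eqxx x4 /= (agree rho s3 s2 d) //.
    by rewrite (agree rho s2 s d) // => i hi; rewrite a2 ?a1 //; lia.
  - by rewrite /upd -a4 //; repeat case: eqP => //; lia.
  - by move=> i hi; rewrite /upd -a3 // -a4; repeat case: eqP => //; lia.
  - by move=> i; have := b4 i; rewrite /upd; repeat case: eqP => //; lia.
- rewrite /=; have := IH1 (take j rho ++ drop (j + k) rho) d s.
  rewrite map_cat map_take map_drop; apply => //.
  apply/allP => i; rewrite mem_cat => /orP[/mem_take|/mem_drop]; exact: (allP hr).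
Qed.

Lemma expr_polynomial_time e (L : seq bool -> Prop) :
  (forall w, den w [::] e != 0 <-> L w) -> polynomial_time L.
Proof.
move=> h; apply: (@program_polynomial_time (compile [::] 0 e) (cost e)).
  exact: polynomial_cost.
move=> w; have [s' r [e0 _ _]] := @evaluates_compile w e [::] 0 (fun=> 0) isT (fun=> leq0n _).
by exists s'; rewrite e0.
Qed.

(* The b-th number of a concatenation of unary codes. *)
Fixpoint block (w : seq bool) (b : nat) : nat :=
  match w with
  | [::] => 0
  | true :: w' => (b == 0) + block w' b
  | false :: w' => if b is b'.+1 then block w' b' else 0
  end.

(** * Logic, counting and unary decoding as expressions *)

Definition eNot e := If e (Cst false) (Cst true).
Definition eAnd e1 e2 := If e1 e2 (Cst false).
Definition eImp e1 e2 := If e1 e2 (Cst true).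
Definition eLe e1 e2 := eNot (Minus e1 e2).
Definition eLt e1 e2 := Minus e2 e1.
Definition eEq e1 e2 := eAnd (eLe e1 e2) (eLe e2 e1).
(** [Rec] binds an index and an accumulator; [Wk 1 1] hides the latter, so that [e] sees only the
    quantified variable, at index 0. *)
Definition eAll e := Rec (Cst true) (If (Var 1) (Wk 1 1 e) (Cst false)).
Definition eEx e := Rec (Cst false) (If (Var 1) (Cst true) (Wk 1 1 e)).
Definition eCount e :=
  Rec (Cst false) (If (Wk 1 1 e) (Plus (Var 1) (Cst true)) (Var 1)).
Definition eLength := Rec (Cst false) (Var 0).
Definition eZeros e :=
  eCount (eAnd (eLt (Var 0) (Wk 0 1 e)) (eNot (Bit (Var 0)))).
(** A one belongs to the b-th unary code exactly when b zeros precede it, so counting such ones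
    decodes the b-th number. *)
Definition eBlock e :=
  eCount (eAnd (Bit (Var 0)) (eEq (eZeros (Var 0)) (Wk 0 1 e))).

Lemma foldl_cons (S T : Type) (f : S -> T -> S) a x s :
  foldl f a (x :: s) = foldl f (f a x) s.
Proof. by []. Qed.

Section Macros.
Variable w : seq bool.
Let n := size w.
Hypothesis n_gt0 : 0 < n.
Implicit Types (env : seq nat) (e : expr).

Definition holds env e := den w env e != 0.

Lemma den_true env : den w env (Cst true) = 1.
Proof. by rewrite /= -/n; lia. Qed.

Lemma den_false env : den w env (Cst false) = 0.
Proof. by rewrite /= minn0. Qed.

Lemma den_Wk1 x env e : den w (x :: env) (Wk 0 1 e) = den w env e.
Proof. by rewrite /= drop0. Qed.

Lemma den_Wk2 x y env e : den w [:: x, y & env] (Wk 0 2 e) = den w env e.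
Proof. by rewrite /= drop0. Qed.

Lemma den_Wk11 x y env e : den w [:: x, y & env] (Wk 1 1 e) = den w (x :: env) e.
Proof. by rewrite /= drop0. Qed.

Lemma den_If env e1 e2 e3 :
  den w env (If e1 e2 e3) = if holds env e1 then den w env e2 else den w env e3.
Proof. by rewrite /= /holds; case: eqP. Qed.

Lemma holds_If env e1 e2 e3 :
  holds env (If e1 e2 e3) = if holds env e1 then holds env e2 else holds env e3.
Proof. by rewrite {1}/holds den_If; case: ifP. Qed.

Lemma holds_true env : holds env (Cst true).
Proof. by rewrite /holds den_true. Qed.

Lemma holds_false env : holds env (Cst false) = false.
Proof. by rewrite /holds den_false. Qed.

Lemma holds_not env e : holds env (eNot e) = ~~ holds env e.
Proof. by rewrite holds_If holds_true holds_false; case: ifP. Qed.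

Lemma holds_and env e1 e2 : holds env (eAnd e1 e2) = holds env e1 && holds env e2.
Proof. by rewrite holds_If holds_false; case: ifP. Qed.

Lemma holds_imp env e1 e2 : holds env (eImp e1 e2) = (holds env e1 ==> holds env e2).
Proof. by rewrite holds_If holds_true; case: ifP. Qed.

Lemma holds_le env e1 e2 : holds env (eLe e1 e2) = (den w env e1 <= den w env e2).
Proof. by rewrite holds_not negbK /= subn_eq0. Qed.

Lemma holds_lt env e1 e2 : holds env (eLt e1 e2) = (den w env e1 < den w env e2).
Proof. by rewrite /holds /= subn_eq0 -ltnNge. Qed.

Lemma holds_eq env e1 e2 : holds env (eEq e1 e2) = (den w env e1 == den w env e2).
Proof. by rewrite holds_and !holds_le eqn_leq. Qed.

Lemma holds_bit env e : holds env (Bit e) = nth false w (den w env e).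
Proof. by rewrite /holds /=; case: (nth _ _ _). Qed.

Lemma den_Rec env e1 e2 :
  den w env (Rec e1 e2) =
  foldl (fun a p => den w [:: p, a & env] e2) (den w env e1) (iota 0 n.+1).
Proof. by []. Qed.

Lemma holds_all env e :
  reflect (forall p, p <= n -> holds (p :: env) e) (holds env (eAll e)).
Proof.
have -> : holds env (eAll e) = all (fun p => holds (p :: env) e) (iota 0 n.+1).
  suff gen s : forall a,
      (foldl (fun a p => den w [:: p, a & env] (If (Var 1) (Wk 1 1 e) (Cst false)))
         a s != 0) = (a != 0) && all (fun p => holds (p :: env) e) s.
    by rewrite {1}/holds den_Rec gen den_true.
  elim: s => [|p s IH] a; first by rewrite andbT.
  rewrite foldl_cons IH den_If den_Wk11 den_false /holds andbA.
  by congr (_ && _); rewrite [den w _ (Var 1)]/=; case: ifP.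
apply: (iffP allP) => h p; first by move=> hp; apply: h; rewrite mem_iota.
by rewrite mem_iota => hp; apply: h.
Qed.

Lemma holds_ex env e :
  reflect (exists2 p, p <= n & holds (p :: env) e) (holds env (eEx e)).
Proof.
have -> : holds env (eEx e) = has (fun p => holds (p :: env) e) (iota 0 n.+1).
  suff gen s : forall a,
      (foldl (fun a p => den w [:: p, a & env] (If (Var 1) (Cst true) (Wk 1 1 e)))
         a s != 0) = (a != 0) || has (fun p => holds (p :: env) e) s.
    by rewrite {1}/holds den_Rec gen den_false.
  elim: s => [|p s IH] a; first by rewrite orbF.
  rewrite foldl_cons IH den_If den_Wk11 den_true /holds orbA.
  by congr (_ || _); rewrite [den w _ (Var 1)]/=; case: ifP.
apply: (iffP hasP) => -[p hp h]; exists p => //; by rewrite mem_iota in hp *.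
Qed.

(** There are n + 1 indices but values stop at n, whence the minimum. *)
Lemma den_count env e :
  den w env (eCount e) = minn n (count (fun p => holds (p :: env) e) (iota 0 n.+1)).
Proof.
suff gen s : forall a, a <= n ->
    foldl (fun a p => den w [:: p, a & env]
      (If (Wk 1 1 e) (Plus (Var 1) (Cst true)) (Var 1))) a s =
    minn n (a + count (fun p => holds (p :: env) e) s).
  by rewrite den_Rec den_false gen.
elim: s => [|p s IH] a han; first by rewrite /= addn0 (minn_idPr han).
rewrite foldl_cons den_If {1}/holds den_Wk11 -/(holds (p :: env) e).
rewrite [count _ _]/=; case: ifP => h; last by rewrite IH.
rewrite [den w _ _]/= -/n (minn_idPr n_gt0) IH ?geq_minl // addnA.
by case: (leqP a.+1 n) => ?; [congr minn; lia|lia].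
Qed.

Lemma den_length env : den w env eLength = n.
Proof. by rewrite den_Rec -addn1 iotaD foldl_cat. Qed.

Lemma den_zeros env e : den w env e <= n ->
  den w env (eZeros e) = count negb (take (den w env e) w).
Proof.
move=> hq; rewrite den_count.
under eq_count => p do rewrite holds_and holds_lt den_Wk1 holds_not holds_bit /=.
set q := den w env e in hq *.
have -> : count (fun p => (p < q) && ~~ nth false w p) (iota 0 n.+1) =
  count negb (take q w).
  have -> : n.+1 = q + (n.+1 - q) by lia.
  rewrite iotaD count_cat addnC (@eq_in_count _ _ pred0) ?count_pred0.
    rewrite add0n -[in RHS](mkseq_nth false w) /mkseq -map_take take_iota.
    rewrite (minn_idPl hq) count_map; apply: eq_in_count => p.
    by rewrite mem_iota /= => ->.
  by move=> p; rewrite mem_iota => hp; apply/negbTE; lia.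
apply/minn_idPr/(leq_trans (count_size _ _)).
by rewrite size_take -/n; case: ifP => //; lia.
Qed.

Lemma count_block b :
  count (fun p => nth false w p && (count negb (take p w) == b)) (iota 0 n) = block w b.
Proof.
rewrite /n; elim: (w) b => [|x v IH] b //=.
rewrite -[1]/(1 + 0) iotaDl count_map /=.
case: x => /=; rewrite ?take0 /=.
  by rewrite [0 == b]eq_sym -IH.
case: b => [|b]; last by rewrite -IH.
by rewrite (@eq_count _ _ pred0) ?count_pred0 // => p /=; rewrite andbF.
Qed.

Lemma block_le b : block w b <= n.
Proof.
by rewrite -count_block (leq_trans (count_size _ _)) ?size_iota.
Qed.

Lemma den_block env e : den w env (eBlock e) = block w (den w env e).
Proof.
rewrite den_count (@eq_in_count _ _
  (fun p => nth false w p && (count negb (take p w) == den w env e))).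
  rewrite -addn1 iotaD count_cat count_block /= nth_default //= !addn0.
  by rewrite (minn_idPr (block_le _)).
move=> p; rewrite mem_iota => hp.
by rewrite holds_and holds_bit holds_eq den_Wk1 den_zeros.
Qed.

End Macros.

(** * Instances *)

Lemma block_unary0 v w : block (unary v ++ w) 0 = v.
Proof. by elim: v => //= v ->. Qed.

Lemma block_unaryS v w b : block (unary v ++ w) b.+1 = block w b.
Proof. by elim: v => //= v ->. Qed.

Lemma block_flatten vs b : block (flatten (map unary vs)) b = nth 0 vs b.
Proof.
by elim: vs b => [|v vs IH] [|b] //=; rewrite ?block_unary0 // block_unaryS IH.
Qed.

Lemma count_flatten_unary vs : count negb (flatten (map unary vs)) = size vs.
Proof.
elim: vs => //= v vs IH; rewrite count_cat IH -[RHS]add1n; congr (_ + _).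
by elim: v.
Qed.

(** The hypothesis says that no one follows the last zero, so the word does not end in an unfinished
    code. *)
Lemma flatten_block w : block w (count negb w) = 0 ->
  w = flatten [seq unary (block w b) | b <- iota 0 (count negb w)].
Proof.
elim: w => [|[] w IH] //=.
  rewrite add0n; case e: (count negb w) IH => [//|c] IH /IH {1}->.
  rewrite /=; congr (true :: (_ ++ flatten _)).
  by apply/eq_in_map => b; rewrite mem_iota; case: b.
move/IH => {1}->; congr (_ :: flatten _).
by rewrite -[1]/(1 + 0) iotaDl -map_comp.
Qed.

(* The t-th of the three tables following the block that gives m. *)
Definition image w m t x := block w (x + t * m).+1.

(** Characterizes the codes of instances by their blocks alone, which expressions can compute. *)
Definition valid w := let m := block w 0 in
  [/\ count negb w = (m + (m + m)).+1, block w (count negb w) = 0 &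
    forall t, t < 3 -> forall x, x < m ->
      image w m t x < m /\ forall y, y < x -> image w m t y <> image w m t x].

Lemma table_perm m (f : nat -> nat) :
  (forall x, x < m -> f x < m /\ forall y, y < x -> f y <> f x) ->
  exists s : 'S_m, forall i : 'I_m, f i = s i.
Proof.
move=> h; pose g (i : 'I_m) := Ordinal (proj1 (h i (ltn_ord i))).
have g_inj : injective g.
  move=> i j /(congr1 val) /= e; apply: val_inj => /=.
  case: (ltngtP i j) => // ij.
    by case: (h j (ltn_ord j)) => _ /(_ i ij e) [].
  by case: (h i (ltn_ord i)) => _ /(_ j ij (esym e)) [].
by exists (perm g_inj) => i; rewrite permE.
Qed.

Definition values m (a a1 a2 : 'S_m) : seq nat :=
  m :: [seq val (a i) | i <- enum 'I_m] ++ [seq val (a1 i) | i <- enum 'I_m]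
    ++ [seq val (a2 i) | i <- enum 'I_m].

Lemma encode_instanceE m (a a1 a2 : 'S_m) :
  encode_instance a a1 a2 = flatten (map unary (values a a1 a2)).
Proof.
rewrite /encode_instance /encode_perm /values map_cons !map_cat /= !flatten_cat.
have e (s : 'S_m) : map unary [seq val (s i) | i <- enum 'I_m] =
  [seq unary (val (s i)) | i <- enum 'I_m] by rewrite -map_comp.
by rewrite !e.
Qed.

Lemma size_values m (a a1 a2 : 'S_m) : size (values a a1 a2) = (m + (m + m)).+1.
Proof. by rewrite /= !size_cat !size_map -enumT size_enum_ord. Qed.

Lemma nth_table m (s : 'S_m) vs (i : 'I_m) :
  nth 0 ([seq val (s i) | i <- enum 'I_m] ++ vs) i = s i.
Proof.
rewrite nth_cat size_map size_enum_ord ltn_ord (nth_map i) ?size_enum_ord //.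
by rewrite nth_ord_enum.
Qed.

Lemma nth_skip_table m (s : 'S_m) vs k :
  nth 0 ([seq val (s i) | i <- enum 'I_m] ++ vs) (k + m) = nth 0 vs k.
Proof.
rewrite nth_cat size_map size_enum_ord.
by rewrite ltnNge leq_addl addnK.
Qed.

Section Encoded.
Variables (m : nat) (a a1 a2 : 'S_m).
Let w := encode_instance a a1 a2.

Lemma block_encode0 : block w 0 = m.
Proof. by rewrite /w encode_instanceE block_flatten. Qed.

Lemma image_encode (i : 'I_m) :
  [/\ image w m 0 i = a i, image w m 1 i = a1 i & image w m 2 i = a2 i].
Proof.
rewrite /image /w encode_instanceE !block_flatten /values /=.
rewrite mul0n addn0 mul1n mul2n -addnn addnA nth_table !nth_skip_table nth_table.
by have := nth_table a2 [::] i; rewrite cats0.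
Qed.

Lemma valid_encode : valid w.
Proof.
rewrite /valid block_encode0 /w encode_instanceE.
rewrite count_flatten_unary size_values block_flatten; split=> //.
  by rewrite nth_default // size_values.
have tableP (s : 'S_m) (f : nat -> nat) : (forall i : 'I_m, f i = s i) ->
    forall x, x < m -> f x < m /\ forall y, y < x -> f y <> f x.
  move=> fs x xm; rewrite (fs (Ordinal xm)); split=> // y yx.
  rewrite (fs (Ordinal (ltn_trans yx xm))) => e.
  by have [e'] := perm_inj (val_inj e); move: (yx); rewrite e' ltnn.
rewrite -encode_instanceE -/w.
by move=> [|[|[|//]]] _; [apply: (tableP a)|apply: (tableP a1)|apply: (tableP a2)];
  move=> i; case: (image_encode i).
Qed.

(** A permutation only reorders the codes in its table, so the length is the sum of 1, ..., m. The
    bound 3m < n keeps block indices from being cut off; m^2 <= n makes room for the exponent of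
    [a2]. *)
Lemma size_encode_instance : 3 * m < size w /\ m ^ 2 <= size w.
Proof.
have size_perm (s : 'S_m) : 2 * size (encode_perm s) = m * m.+1.
  rewrite /encode_perm size_flatten /shape -map_comp sumnE big_map.
  rewrite (eq_bigr (fun i : 'I_m => (val (s i)).+1)); last first.
    by move=> i _; rewrite /= size_rcons size_nseq.
  have -> : \sum_(i <- enum 'I_m) (val (s i)).+1 = \sum_(i < m) i.+1.
    by rewrite big_enum [RHS](reindex_perm s).
  elim: (m) => [|k IH]; first by rewrite big_ord0.
  by rewrite big_ord_recr /= mulnDr IH; lia.
rewrite /w /encode_instance !size_cat /unary size_rcons size_nseq.
have := size_perm a; have := size_perm a1; have := size_perm a2.
by rewrite -mulnn; nia.
Qed.

End Encoded.

Lemma valid_instance w : valid w ->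
  exists a a1 a2 : 'S_(block w 0), w = encode_instance a a1 a2.
Proof.
set m := block w 0 => -[hc h0 ht].
have [a ha] := table_perm (ht 0 isT).
have [a1 ha1] := table_perm (ht 1 isT).
have [a2 ha2] := table_perm (ht 2 isT).
exists a, a1, a2; rewrite encode_instanceE.
rewrite {1}(flatten_block h0) hc (map_comp unary); congr (flatten (map _ _)).
have tableE t (s : 'S_m) : (forall i : 'I_m, image w m t i = s i) ->
    [seq val (s i) | i <- enum 'I_m] = [seq block w b | b <- iota (t * m).+1 m].
  move=> hs; rewrite -[in iota _ _](addn0 (t * m).+1) iotaDl -map_comp.
  rewrite -val_enum_ord -map_comp; apply: eq_map => i /=.
  by rewrite -hs /image addnC.
rewrite /values (tableE 0 a) // (tableE 1 a1) // (tableE 2 a2) //.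
by rewrite /= !iotaD !map_cat !mul1n mul2n -addnn.
Qed.

(** * The decision procedure *)

Definition eOffset t em ex := iter t (fun e => Plus e em) ex.
Definition eImage t em ex := eBlock (Plus (eOffset t em ex) (Cst true)).
Definition ePow t em ex ek :=
  Rec ex (If (eLt (Var 0) (Wk 0 2 ek)) (eImage t (Wk 0 2 em) (Var 1)) (Var 1)).
(* The iterate of order [e1 + (n + 1) * e2]. *)
Definition eBigPow t em ex e1 e2 :=
  Rec (ePow t em ex e1) (If (eLt (Var 0) (Wk 0 2 e2))
    (Rec (Var 1) (eImage t (Wk 0 4 em) (Var 1))) (Var 1)).

Definition eTable t :=
  eAll (eImp (eLt (Var 0) (Var 1))
    (eAnd (eLt (eImage t (Var 1) (Var 0)) (Var 1))
      (eAll (eImp (eLt (Var 0) (Var 1))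
        (eNot (eEq (eImage t (Var 2) (Var 0)) (eImage t (Var 2) (Var 1)))))))).

Definition eCodes := eZeros eLength.

(** The number of codes is compared with 3m + 1 by subtractions, since a sum might be cut off. The
    test that it is nonzero excludes 0 codes when m = 0. *)
Definition eValid :=
  eAnd (eAnd eCodes
         (eEq (Minus (Minus (Minus eCodes (Cst true)) (Var 0)) (Var 0)) (Var 0)))
  (eAnd (eNot (eBlock eCodes))
  (eAnd (eTable 0) (eAnd (eTable 1) (eTable 2)))).

(** The selector is quantified over all of 0, ..., n, so every value from 2 on stands for the third
    choice. *)
Definition eSelect es e1 e2 e3 := If es (If (Minus es (Cst true)) e3 e2) e1.

(* Context: j, l, k, s', s, i2, i1, c3, c2, c1, m. *)
Definition eAgree es ek :=
  Let (ePow 1 (Var 10) (eSelect es (Var 9) (Var 8) (Var 7)) ek)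
    (eEq (ePow 2 (Var 11) (eBigPow 1 (Var 11) (Var 0) (Var 7) (Var 6)) (Var 1))
         (eImage 0 (Var 11) (Var 0))).

Definition eSearch :=
  eEx (eEx (eAll (eAll (eAll (eAll (eEx
    (eAnd (eAgree (Var 4) (Var 2)) (eAgree (Var 3) (Var 1))))))))).

Definition eMain :=
  eAll (eAll (eAll (eImp (eAnd (eLt (Var 0) (Var 3))
    (eAnd (eLt (Var 1) (Var 3)) (eLt (Var 2) (Var 3)))) eSearch))).

Definition eDecide := Let (eBlock (Cst false)) (eAnd eValid eMain).

Lemma den_Var w env i : den w env (Var i) = nth 0 env i.
Proof. by []. Qed.

Lemma den_Plus w env e1 e2 :
  den w env (Plus e1 e2) = minn (size w) (den w env e1 + den w env e2).
Proof. by []. Qed.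

Lemma den_Minus w env e1 e2 :
  den w env (Minus e1 e2) = den w env e1 - den w env e2.
Proof. by []. Qed.

Lemma den_Let w env e1 e2 :
  den w env (Let e1 e2) = den w (den w env e1 :: env) e2.
Proof. by []. Qed.

Lemma den_Wk4 w x1 x2 x3 x4 env e :
  den w [:: x1, x2, x3, x4 & env] (Wk 0 4 e) = den w env e.
Proof. by rewrite /= drop0. Qed.

#[local] Arguments den : simpl never.

Lemma foldl_iotaS (S : Type) (f : S -> nat -> S) a k :
  foldl f a (iota 0 k.+1) = f (foldl f a (iota 0 k)) k.
Proof. by rewrite -addn1 iotaD foldl_cat. Qed.

(** * Correctness of the decision procedure *)

Section Correctness.
Variable w : seq bool.
Let n := size w.
Hypothesis n_gt0 : 0 < n.
Implicit Types (env : seq nat) (e : expr).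

Lemma den_offset env t em ex :
  den w env ex + t * den w env em <= n ->
  den w env (eOffset t em ex) = den w env ex + t * den w env em.
Proof.
elim: t => [|t IH] h; first by rewrite addn0.
by rewrite /= den_Plus IH; move: h; rewrite -/n mulSn; lia.
Qed.

Lemma den_image env t em ex :
  den w env ex + t * den w env em < n ->
  den w env (eImage t em ex) = image w (den w env em) t (den w env ex).
Proof.
move=> h; rewrite den_block // /image; congr block.
rewrite den_Plus den_offset ?den_true //; last exact: ltnW.
by move: h; rewrite -/n; lia.
Qed.

Lemma den_codes env : den w env eCodes = count negb w.
Proof. by rewrite (den_zeros n_gt0) den_length ?take_size. Qed.

Lemma holds_table env t m : 3 * m < n -> t < 3 ->
  reflect (forall x, x < m -> image w m t x < m /\
             forall y, y < x -> image w m t y <> image w m t x)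
          (holds w (m :: env) (eTable t)).
Proof.
move=> mn t3.
have im x k pre : nth 0 (pre ++ m :: env) k = x -> x < m ->
    den w (pre ++ m :: env) (eImage t (Var (size pre)) (Var k)) = image w m t x.
  have em : nth 0 (pre ++ m :: env) (size pre) = m by rewrite nth_cat ltnn subnn.
  move=> ex xm; rewrite den_image !den_Var em ex //.
  have : t * m <= 2 * m by rewrite leq_mul2r; lia.
  by lia.
apply: (iffP (holds_all n_gt0 _ _)) => h x hx.
  have := h x ltac:(lia); rewrite holds_imp // holds_and // !holds_lt // !den_Var.
  rewrite (im x 0 [:: x]) //= => /implyP/(_ hx)/andP[-> /(holds_all n_gt0) hy].
  split=> // y yx; have := hy y ltac:(lia).
  rewrite holds_imp // holds_lt // holds_not // holds_eq // !den_Var /= yx /=.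
  by rewrite (im y 0 [:: y; x]) ?(im x 1 [:: y; x]) //; [move/eqP|lia].
rewrite holds_imp // holds_and // !holds_lt // !den_Var /=; apply/implyP => xm.
have [h1 h2] := h x xm; rewrite (im x 0 [:: x]) //= h1.
apply/(holds_all n_gt0) => y hy.
rewrite holds_imp // holds_lt // holds_not // holds_eq // !den_Var /=.
apply/implyP => yx; rewrite (im y 0 [:: y; x]) ?(im x 1 [:: y; x]) //; last by lia.
by apply/eqP; apply: h2.
Qed.

Lemma holds_valid : reflect (valid w) (holds w [:: block w 0] eValid).
Proof.
set m := block w 0.
have hN : count negb w <= n by apply: count_size.
have hm : m <= n by apply: block_le.
set N := count negb w in hN *.
have codes : holds w [:: m] eCodes = (N != 0) by rewrite /holds den_codes.
have last : holds w [:: m] (eBlock eCodes) = (block w N != 0).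
  by rewrite /holds den_block // den_codes.
rewrite /eValid holds_and // holds_and // holds_eq // !holds_and // holds_not //.
rewrite codes last !den_Minus den_codes den_Var den_true // negbK /=.
apply: (iffP idP).
  move=> /andP[/andP[N0 /eqP e] /andP[/eqP e0 /and3P[h0 h1 h2]]].
  rewrite -/N in e.
  have eN : N = (m + (m + m)).+1 by lia.
  have mn : 3 * m < n by lia.
  split=> // -[|[|[|//]]] t3.
  - exact: (holds_table [::] mn t3 h0).
  - exact: (holds_table [::] mn t3 h1).
  - exact: (holds_table [::] mn t3 h2).
move=> [eN e0 ht]; rewrite -/N -/m in eN e0 ht.
have mn : 3 * m < n by lia.
rewrite e0 eqxx -/N eN /=; apply/andP; split; first by apply/eqP; lia.
apply/and3P; split.
- by apply/(@holds_table [::] 0 m mn isT); apply: ht.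
- by apply/(@holds_table [::] 1 m mn isT); apply: ht.
- by apply/(@holds_table [::] 2 m mn isT); apply: ht.
Qed.

Section Powers.
Variables (m t : nat) (s : 'S_m).
Hypothesis m_lt : 3 * m < n.
Hypothesis t_lt : t < 3.
Hypothesis imageE : forall i : 'I_m, image w m t i = s i.

Lemma den_image_perm env em ex (i : 'I_m) : den w env em = m ->
  den w env ex = i -> den w env (eImage t em ex) = s i.
Proof.
move=> hm hx; rewrite den_image hm hx //.
have := ltn_ord i; have : t * m <= 2 * m by rewrite leq_mul2r; lia.
by lia.
Qed.

Lemma den_pow env em ex ek (i : 'I_m) : den w env em = m ->
  den w env ex = i -> den w env ek <= n.+1 ->
  den w env (ePow t em ex ek) = (s ^+ den w env ek)%g i.
Proof.
move=> hm hx hk; rewrite den_Rec hx.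
suff gen r : foldl (fun a p => den w [:: p, a & env]
    (If (eLt (Var 0) (Wk 0 2 ek)) (eImage t (Wk 0 2 em) (Var 1)) (Var 1)))
    i (iota 0 r) = (s ^+ minn r (den w env ek))%g i.
  by rewrite gen (minn_idPr hk).
elim: r => [|r IH]; first by rewrite min0n expg0 perm1.
rewrite foldl_iotaS IH den_If // holds_lt // den_Wk2 !den_Var.
case: ltnP => h.
  rewrite (@den_image_perm _ _ _ ((s ^+ r)%g i)) ?den_Wk2 //.
  by rewrite (minn_idPl h) expgSr permM.
by rewrite (minn_idPr _) //; apply: leqW.
Qed.

(** The inner recursion has no guard and applies [s] in each of its n + 1 rounds; this fixes the
    base n + 1 of the digits. *)
Lemma den_bigpow env em ex e1 e2 (i : 'I_m) : den w env em = m ->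
  den w env ex = i -> den w env e1 <= n -> den w env e2 <= n ->
  den w env (eBigPow t em ex e1 e2) =
  (s ^+ (den w env e1 + n.+1 * den w env e2))%g i.
Proof.
move=> hm hx h1 h2; rewrite den_Rec (den_pow hm hx); last exact: ltnW.
set i1 := den w env e1; set i2 := den w env e2.
suff gen r : foldl (fun a p => den w [:: p, a & env]
    (If (eLt (Var 0) (Wk 0 2 e2))
      (Rec (Var 1) (eImage t (Wk 0 4 em) (Var 1))) (Var 1)))
    ((s ^+ i1)%g i) (iota 0 r) = (s ^+ (i1 + n.+1 * minn r i2))%g i.
  by rewrite gen (minn_idPr _) //; apply: leqW.
elim: r => [|r IH]; first by rewrite min0n muln0 addn0.
rewrite foldl_iotaS IH den_If // holds_lt // den_Wk2 !den_Var -/i2.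
case: ltnP => h; last by rewrite (minn_idPr _) //; apply: leqW.
rewrite den_Rec (minn_idPl h) den_Var.
set x := (s ^+ _)%g i.
have gen q : foldl (fun a p => den w [:: p, a, r, val x & env]
    (eImage t (Wk 0 4 em) (Var 1))) x (iota 0 q) = (s ^+ q)%g x.
  elim: q => [|q IHq]; first by rewrite expg0 perm1.
  rewrite foldl_iotaS IHq (@den_image_perm _ _ _ ((s ^+ q)%g x)) //.
    by rewrite expgSr permM.
  by rewrite den_Wk4.
by rewrite gen /x -permM -expgD mulnSr addnA.
Qed.

End Powers.

Section Main.
Variables (m : nat) (a a1 a2 : 'S_m).
Hypothesis m_lt : 3 * m < n.
Hypothesis m_sq : m ^ 2 <= n.
Hypothesis imageE : forall i : 'I_m,
  [/\ image w m 0 i = a i, image w m 1 i = a1 i & image w m 2 i = a2 i].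

Lemma holds_agree (c1 c2 c3 : 'I_m) i1 i2 s s' k l j es ek :
  i1 <= n -> i2 <= n -> j <= n ->
  let env := [:: j; l; k; s'; s; i2; i1; val c3; val c2; val c1; m] in
  den w env ek <= n ->
  let x := (a1 ^+ den w env ek)%g
    (nth c1 [:: c1; c2; c3] (minn (den w env es) 2)) in
  holds w env (eAgree es ek) =
  ((a1 ^+ (i1 + n.+1 * i2) * a2 ^+ j)%g x == a x).
Proof.
move=> h1 h2 hj env hk x.
have im0 (i : 'I_m) : image w m 0 i = a i by case: (imageE i).
have im1 (i : 'I_m) : image w m 1 i = a1 i by case: (imageE i).
have im2 (i : 'I_m) : image w m 2 i = a2 i by case: (imageE i).
rewrite /holds den_Let -/(holds w _ _).
have -> : den w env (ePow 1 (Var 10) (eSelect es (Var 9) (Var 8) (Var 7)) ek) = x.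
  apply: den_pow => //; last exact: leqW.
  rewrite !den_If // /holds den_Minus den_true //.
  by case: (den w env es) => [|[|q]] //=; rewrite !minnSS minn0.
rewrite holds_eq // (den_image_perm m_lt _ im0 (i := x)) //.
rewrite (den_pow m_lt _ im2 (i := (a1 ^+ (i1 + n.+1 * i2))%g x)) //; last exact: leqW.
  by rewrite permM.
by rewrite (den_bigpow m_lt _ im1 (i := x)).
Qed.

Lemma holds_main : holds w [:: m] eMain <->
  exists i1 i2 : nat, a = (a1 ^+ i1 * a2 ^+ i2)%g.
Proof.
have hN : #|'I_m| ^ 2 <= n.+1 by rewrite card_ord; apply: leqW.
apply: iff_trans (iff_sym (knapsackP a a1 a2 hN)); split=> h.
  move=> c1 c2 c3; have lc (c : 'I_m) : c <= n by have := ltn_ord c; lia.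
  move/(holds_all n_gt0)/(_ _ (lc c1))/(holds_all n_gt0)/(_ _ (lc c2)): h.
  move/(holds_all n_gt0)/(_ _ (lc c3)).
  rewrite holds_imp // !holds_and // !holds_lt // !den_Var /= !ltn_ord /=.
  move=> /(holds_ex n_gt0)[i1 h1] /(holds_ex n_gt0)[i2 h2] h.
  exists i1, i2; split=> // c d k l hc hd hk hl.
  have idx b : b \in [:: c1; c2; c3] -> index b [:: c1; c2; c3] <= n /\
      nth c1 [:: c1; c2; c3] (minn (index b [:: c1; c2; c3]) 2) = b.
    move=> hb; have := hb; rewrite -index_mem => hi.
    rewrite (minn_idPl _) ?nth_index //; split=> //.
    (* The existence of [b] gives m > 0, hence n > 3, so the indices 0, 1, 2 are in the range of the
       quantifier. *)
    by have := ltn_ord b; move: hi => /=; lia.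
  have [hs es] := idx c hc; have [hs' es'] := idx d hd.
  move/(holds_all n_gt0)/(_ _ hs)/(holds_all n_gt0)/(_ _ hs'): h.
  move/(holds_all n_gt0)/(_ _ hk)/(holds_all n_gt0)/(_ _ hl).
  move=> /(holds_ex n_gt0)[j hj]; rewrite holds_and // !holds_agree //.
  rewrite !den_Var => /andP[/eqP e1 /eqP e2]; exists j => //.
  by move: e1 e2; rewrite /= es es'.
apply/(holds_all n_gt0) => p1 _; apply/(holds_all n_gt0) => p2 _.
apply/(holds_all n_gt0) => p3 _.
rewrite holds_imp // !holds_and // !holds_lt // !den_Var /=.
apply/implyP => /and3P[l3 l2 l1].
pose c1 := Ordinal l1; pose c2 := Ordinal l2; pose c3 := Ordinal l3.
have [i1 [i2 [h1 h2 hi]]] := h c1 c2 c3.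
apply/(holds_ex n_gt0); exists i1 => //; apply/(holds_ex n_gt0); exists i2 => //.
apply/(holds_all n_gt0) => s _; apply/(holds_all n_gt0) => s' _.
apply/(holds_all n_gt0) => k hk; apply/(holds_all n_gt0) => l hl.
have mem q : nth c1 [:: c1; c2; c3] (minn q 2) \in [:: c1; c2; c3].
  by apply: mem_nth; rewrite ltnS geq_minr.
have [j hj [e1 e2]] := hi _ _ k l (mem s) (mem s') hk hl.
apply/(holds_ex n_gt0); exists j => //; rewrite holds_and //.
rewrite (@holds_agree c1 c2 c3) // (@holds_agree c1 c2 c3) //.
by rewrite !den_Var /= e1 e2 !eqxx.
Qed.

End Main.
End Correctness.

Theorem theorem5p8 :
  polynomial_time (fun w : seq bool =>
    exists (m : nat) (a a1 a2 : 'S_m),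
      w = encode_instance a a1 a2 /\
      exists i1 i2 : nat, a = (a1 ^+ i1 * a2 ^+ i2)%g).
Proof.
apply: (@expr_polynomial_time eDecide) => w.
(* On the empty input [eDecide] evaluates to 0, and no instance has an empty code because 3m < n. *)
have [/size0nil ->|n0] := posnP (size w).
  split=> // -[m [a [a1 [a2 [e _]]]]].
  by have [] := size_encode_instance a a1 a2; rewrite -e.
rewrite den_Let den_block // den_false -/(holds _ _ _) holds_and //.
split.
  move=> /andP[/(holds_valid n0) v h].
  have [a [a1 [a2 e]]] := valid_instance v.
  exists (block w 0), a, a1, a2; split=> //.
  have [h1 h2] := size_encode_instance a a1 a2; rewrite -e in h1 h2.
  apply/(holds_main n0 h1 h2); last exact: h.
  by move=> i; have := image_encode a a1 a2 i; rewrite -e.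
move=> [m [a [a1 [a2 [e h]]]]].
have em : block w 0 = m by rewrite e block_encode0.
have [h1 h2] := size_encode_instance a a1 a2; rewrite -e in h1 h2.
apply/andP; split; first by apply/holds_valid => //; rewrite e; apply: valid_encode.
rewrite em; apply/(holds_main n0 h1 h2 (a := a) (a1 := a1) (a2 := a2)) => //.
by move=> i; have := image_encode a a1 a2 i; rewrite -e.
Qed.
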